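(* Assume that $\mathbf{f}'(\mathbf{x}^* )$ is singular, i.e., $\alpha=0$ and $c=1$. Let $r_0,\mu_0,\nu_0>0$ be constants such that $$\|P_{\mathcal N}\mathbf{f}'(\mathbf{x})^{-1}\|\le\mu_0\|\mathbf{x}-\mathbf{x}^*\|^{-1}\quad\text{and}\quad\|P_{\mathcal R}\mathbf{f}'(\mathbf{x})^{-1}\|\le\nu_0$$ for any $\mathbf{x}\in\mathbb{R}^{2n}$ satisfying $\mathbf{0}<\mathbf{x}<\mathbf{x}^*$ and $\|\mathbf{x}-\mathbf{x}^*\|\le r_0$. For $r,\theta>0$ let $$\mathcal W(r,\theta)=\left\{\mathbf{x}\in\mathbb{R}^{2n}\ \middle|\ \|\mathbf{x}-\mathbf{x}^*\|<r,\ \|P_{\mathcal R}(\mathbf{x}-\mathbf{x}^* )\|\le\theta\|P_{\mathcal N}(\mathbf{x}-\mathbf{x}^* )\|\right\}.$$ Let $\{\mathbf{x}_k\},\{\mathbf{y}_k\}$ and $\{\mathbf{z}_k\}$ be the sequences generated by the two-step modified Newton method starting from an initial guess $\mathbf{x}_0\in\mathcal W(r,\theta)$ with $0<\theta<\min\{1/(\mu_0\|\mathbf{f}''(\mathbf{x}^* )\|),1\}$ and $$r=\min\left\{r_0,\ \frac{\theta(1-\mu_0\theta\|\mathbf{f}''(\mathbf{x}^* )\|)}{2\nu_0(1+\theta)\|\mathbf{f}''(\mathbf{x}^* )\|}\right\}.$$ Then the sequences $\{\mathbf{x}_k\},\{\mathbf{y}_k\}$ and $\{\mathbf{z}_k\}$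 remain in $\mathcal W(r,\theta)$, and the error bound $$\|\mathbf{x}^*-\mathbf{x}_{k+1}\|\le\frac{(1+\theta)(1+\mu_0\theta\|\mathbf{f}''(\mathbf{x}^* )\|)}{2(1-\theta)}\,\|\mathbf{x}^*-\mathbf{x}_k\|$$ holds for all $k\ge0$.
   Context: Data. Let $n\ge1$, $c\in(0,1]$, $\alpha\in[0,1)$. Let $\{\omega_i\}_{i=1}^n$ and $\{c_i\}_{i=1}^n$ be the Gauss-Legendre nodes and weights on $[0,1]$, with $0<\omega_n<\cdots<\omega_1<1$, $c_i>0$, $\sum_{i=1}^n c_i=1$. Put $\delta_i=\frac{1}{c\omega_i(1+\alpha)}$, $\gamma_i=\frac{1}{c\omega_i(1-\alpha)}$, $q_i=\frac{c_i}{2\omega_i}$, $P=\left(\frac{q_j}{\delta_i+\gamma_j}\right)_{n\times n}$, $\widetilde P=\left(\frac{q_j}{\gamma_i+\delta_j}\right)_{n\times n}$, and let $\mathbf{e}=(1,\dots,1)^\top\in\mathbb{R}^n$. With $\circ$ the componentwise (Hadamard) product, define for $\mathbf{x}=[\mathbf{u}^\top,\mathbf{v}^\top]^\top$, $\mathbf{u},\mathbf{v}\in\mathbb{R}^n$, $$\mathbf{f}(\mathbf{x})=\begin{bmatrix}\mathbf{u}-\mathbf{u}\circ(P\mathbf{v})-\mathbf{e}\\ \mathbf{v}-\mathbf{v}\circ(\widetilde P\mathbf{u})-\mathbf{e}\end{bmatrix}\in\mathbb{R}^{2n}.$$ $\mathbf{f}'(\mathbf{x})$ is the Jacobian matrix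 and $\mathbf{f}''(\mathbf{x})$ the second derivative, a symmetric bilinear map $\mathbb{R}^{2n}\times\mathbb{R}^{2n}\to\mathbb{R}^{2n}$, which here does not depend on $\mathbf{x}$. Inequalities between vectors are entrywise ($<$ means strict in every component). $\mathbf{x}^*$ denotes the minimal positive solution of $\mathbf{f}(\mathbf{x})=\mathbf{0}$. It is known that $\mathbf{f}'(\mathbf{x}^* )$ is singular if and only if $\alpha=0$ and $c=1$, and that $\mathbf{f}'(\mathbf{x})$ is nonsingular whenever $\mathbf{0}\le\mathbf{x}<\mathbf{x}^*$. Two-step modified Newton method: given $\mathbf{x}_0$, set $\mathbf{z}_{-1}=\mathbf{x}_0$ and for $k=0,1,2,\dots$ $$\mathbf{y}_k=\mathbf{x}_k-\mathbf{f}'(\mathbf{z}_{k-1})^{-1}\mathbf{f}(\mathbf{x}_k),\qquad \mathbf{z}_k=\tfrac12(\mathbf{x}_k+\mathbf{y}_k),\qquad \mathbf{x}_{k+1}=\mathbf{x}_k-\mathbf{f}'(\mathbf{z}_k)^{-1}\mathbf{f}(\mathbf{x}_k).$$ Projections. Let $\mathcal N=\ker(\mathbf{f}'(\mathbf{x}^* ))$ and $\mathcal R=\operatorname{range}(\mathbf{f}'(\mathbf{x}^* ))$. $P_{\mathcal N}$ and $P_{\mathcal R}$ are the orthogonal projections onto $\mathcal N$ and $\mathcal R$, respectively. In the singular case the following is taken from the literature: $\dim\mathcal N=1$, $\mathbb{R}^{2n}=\mathcal N\oplus\mathcal R$, $I=P_{\mathcal N}+P_{\mathcal R}$, and the restriction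 $\mathbf{f}'(\mathbf{x}^* )|_{\mathcal R}$ is invertible on $\mathcal R$. The set $\mathcal W(r,\theta)$ is introduced for $r,\theta>0$ sufficiently small. The existence of constants $r_0,\mu_0,\nu_0>0$ as in the claim is likewise known in the singular case. Norms. $\|\cdot\|$ is a norm on $\mathbb{R}^{2n}$ (not further specified), the norm on a subspace being the same; norms of linear and bilinear maps are the corresponding operator norms.
   Formalization: For n≥2 the Euclidean orthogonal projections onto N and R do not satisfy I = P_N + P_R as the source assumes; here P_N and P_R are the complementary projections of R^{2n} = N ⊕ R, orthogonal for some inner product (Euclidean allowed). *)

(* Defs.v *)
(* Vectors of R^m are row vectors and linear maps act on the right:
   'd f x h = h *m 'J f x, so 'J f x is the transpose of the column-vector
   Jacobian matrix, its kernel is the row space of kermx ('J f x), and its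
   range is the row space of 'J f x itself. *)
From HB Require Import structures.
From mathcomp Require Export all_boot all_order all_algebra.
From mathcomp Require Export all_classical all_reals all_analysis.
Export numFieldNormedType.Exports.
Export Order.TTheory GRing.Theory Num.Theory.

Set Implicit Arguments.
Unset Strict Implicit.
Unset Printing Implicit Defensive.

Local Open Scope classical_set_scope.
Local Open Scope ring_scope.

Section GaussLegendre.
Variables (R : realType) (n : nat).

(* P_n(2 X - 1), by Rodrigues' formula transported to [0, 1] *)
Definition shifted_legendre : {poly R} :=
  (n`!%:R)^-1 *: (('X^2 - 'X) ^+ n)^`(n).

(* The n nodes are pairwise distinct, hence they are all the roots; the weights
   are the integrals of the Lagrange basis polynomials of the nodes. *)
Record gauss_legendre (omega wt : 'I_n -> R) : Prop := GaussLegendre {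
  gl_gt0  : forall i, 0 < omega i;
  gl_lt1  : forall i, omega i < 1;
  gl_decr : forall i j : 'I_n, (i < j)%N -> omega j < omega i;
  gl_root : forall i, root shifted_legendre (omega i);
  gl_wtE  : forall i, wt i =
    \int[lebesgue_measure]_(t in `[0, 1])
      \prod_(j < n | j != i) ((t - omega j) / (omega i - omega j));
  gl_wt_gt0 : forall i, 0 < wt i;
  gl_wt_sum : \sum_i wt i = 1
}.

End GaussLegendre.

Section VectorEquation.
Variables (R : realType) (n : nat) (c alpha : R) (omega wt : 'I_n -> R).

Definition delta_ (i : 'I_n) : R := (c * omega i * (1 + alpha))^-1.
Definition gamma_ (i : 'I_n) : R := (c * omega i * (1 - alpha))^-1.
Definition q_ (i : 'I_n) : R := wt i / (2 * omega i).

Definition Pmx : 'M[R]_n := \matrix_(i, j) (q_ j / (delta_ i + gamma_ j)).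
Definition Ptmx : 'M[R]_n := \matrix_(i, j) (q_ j / (gamma_ i + delta_ j)).

(* x = [u, v]; P v is computed on the column v^T *)
Definition fvec (x : 'rV[R]_(n + n)) : 'rV[R]_(n + n) :=
  let u := lsubmx x in let v := rsubmx x in
  row_mx (\row_i (u 0 i - u 0 i * (Pmx *m v^T) i 0 - 1))
         (\row_i (v 0 i - v 0 i * (Ptmx *m u^T) i 0 - 1)).

End VectorEquation.

Section Vectors.
Variables (R : realType) (m : nat).
Implicit Types (x y h k : 'rV[R]_m) (f : 'rV[R]_m -> 'rV[R]_m).

Definition lev x y := forall i, x 0 i <= y 0 i.
Definition ltv x y := forall i, x 0 i < y 0 i.

Definition minimal_positive_solution f x :=
  [/\ ltv 0 x, f x = 0 & forall y, ltv 0 y -> f y = 0 -> lev x y].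

Definition second_derivative f x h k : 'rV[R]_m :=
  'D_k (fun y => 'D_h f y) x.

(* P is the orthogonal projection onto the row space of V for the inner product
   <x, y> = x *m G *m y^T: P is idempotent with image V, and self-adjoint. *)
Definition inner_product (G : 'M[R]_m) :=
  G^T = G /\ forall x, x != 0 -> 0 < (x *m G *m x^T) 0 0.

Definition orth_proj (G V P : 'M[R]_m) :=
  [/\ P *m P = P, (P :=: V)%MS & P *m G = G *m P^T].

(* The identity I = P_N + P_R says that N = ker A and Rg = range A are
   orthogonal complements for G.  When A is the singular Jacobian at the
   minimal positive solution xs, N is spanned by [omega u, omega u], where
   xs = [u, u], and Rg is the Euclidean complement of [wt, wt]: these
   are not orthogonal for the standard inner product when 2 <= n, which is why
   G is a parameter. *)
Definition kernel_range_projections (G A PN PR : 'M[R]_m) :=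
  [/\ inner_product G, orth_proj G (kermx A) PN, orth_proj G A PR
    & PN + PR = 1%:M].

Record is_norm (nrm : 'rV[R]_m -> R) : Prop := IsNorm {
  norm_triangle : forall x y, nrm (x + y) <= nrm x + nrm y;
  norm_homogeneous : forall (a : R) x, nrm (a *: x) = `|a| * nrm x;
  norm_definite : forall x, nrm x = 0 -> x = 0
}.

(* Operator norms for nrm; the library norm of 'rV[R]_m is only used, through
   'd and 'D, for its topology. *)
Variable nrm : 'rV[R]_m -> R.

Definition opnorm (A : 'M[R]_m) : R :=
  sup [set nrm (h *m A) | h in [set h | nrm h <= 1]].

Definition bilin_opnorm (b : 'rV[R]_m -> 'rV[R]_m -> 'rV[R]_m) : R :=
  sup [set nrm (b hk.1 hk.2) | hk in [set hk | nrm hk.1 <= 1 /\ nrm hk.2 <= 1]].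

Definition Wset (PN PR : 'M[R]_m) (xs : 'rV[R]_m) (r theta : R) :
    set 'rV[R]_m :=
  [set x | nrm (x - xs) < r /\
           nrm ((x - xs) *m PR) <= theta * nrm ((x - xs) *m PN)].

End Vectors.

Section TwoStepNewton.
Variables (R : realType) (m : nat) (f : 'rV[R]_m -> 'rV[R]_m).

(* z_{k-1}, with z_{-1} = x_0 *)
Definition zprev (x z : nat -> 'rV[R]_m) (k : nat) : 'rV[R]_m :=
  if k is k'.+1 then z k' else x 0%N.

(* invmx A is only the inverse of A when A \in unitmx, hence the two
   nonsingularity clauses: they say that the iteration is well defined. *)
Definition two_step_newton (x y z : nat -> 'rV[R]_m) := forall k,
  [/\ 'J f (zprev x z k) \in unitmx,
      y k = x k - f (x k) *m invmx ('J f (zprev x z k)),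
      z k = 2^-1 *: (x k + y k),
      'J f (z k) \in unitmx
    & x k.+1 = x k - f (x k) *m invmx ('J f (z k))].

End TwoStepNewton.

(* Main.v *)
(* The hypothesis on f'(x)^-1 is only used along x = xs - t phi, where phi > 0
   spans the kernel of f'(xs), in the limit t -> 0+.  This is essential: the
   iterates need not satisfy 0 < x < xs.

   Let s(h) = (wt.h_u + wt.h_v) / 2 and d(h) = (wt.h_u - wt.h_v) / 2.  Because
   wt_i P_ij + wt_j P_ji = wt_i wt_j / 2, the component of f''(h, k) along phi is
   governed by s(f''(h, k)) = - (s(h) s(k) - d(h) d(k)) / 2; moreover s vanishes
   on the range and d(phi) = 0.  The limit t -> 0+ bounds the inverse of f'(xs)
   on the range by nu0 and gives |a(h) a(k) - b(h) b(k)| <= mu0 B |h| |k|, where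
   a and b are s and d normalized by a(phi) = 1.

   Each Newton step e -> e' with Jacobian at xs + zeta satisfies
     e' f'(xs) + f''(zeta, e') = f''(zeta, e) - f''(e, e) / 2.
   Its phi-component is the scalar recursion a' = a - a^2 / (2 a_zeta), perturbed
   only by products of range components; its range component is quadratically
   small.  With rho = mu0 B theta < 1 and p = |range component| / theta, an
   invariant p <= 3 N a, with N as in cone_params, propagates from the first
   iterate on; cone membership, norms and the contraction follow from it. *)
Require Import Defs.
From HB Require Import structures.
From mathcomp Require Import ring lra.

Set Implicit Arguments.
Unset Strict Implicit.
Unset Printing Implicit Defensive.

Local Open Scope classical_set_scope.
Local Open Scope ring_scope.

(** * Scalar estimates *)

(** [N] is the bound that the radius gives for [nu0 * B * nrm e * (1 + rho)], with [e] the initial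
    error: the factor [1 - rho] in [r] becomes [1 - rho ^+ 2]. The condition [theta <= rho] stands
    for [1 <= mu0 * B]. *)
Definition cone_params (R : realFieldType) (theta rho N : R) :=
  [/\ 0 < theta, theta <= rho, rho < 1
    & 2 * (N * (1 + theta)) = theta * (1 - rho ^+ 2)].

Section ConeParams.
Variables (R : realFieldType) (theta rho N : R).

Lemma cone_params_gt0 : cone_params theta rho N -> 0 < N.
Proof.
move=> [t0 tr r1 NE].
have h1 : 0 < 1 + theta by lra.
have : 0 < theta * ((1 - rho) * (1 + rho)) by rewrite !mulr_gt0; lra.
move=> h2; suff: 0 < N * (1 + theta) by rewrite pmulr_lgt0.
lra.
Qed.

Lemma cone_params_le_rho : cone_params theta rho N -> N <= rho * (1 - rho) / 2.
Proof.
move=> [t0 tr r1 NE].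
have : N * (1 + theta) <= (rho * (1 - rho) / 2) * (1 + theta).
  have : 0 <= (1 - rho) * (rho - theta) by rewrite mulr_ge0; lra.
  by lra.
by rewrite ler_pM2r//; lra.
Qed.

Lemma cone_params_le_theta : cone_params theta rho N -> N <= theta * (1 - theta) / 2.
Proof.
move=> [t0 tr r1 NE].
have : N * (1 + theta) <= (theta * (1 - theta) / 2) * (1 + theta).
  have : 0 <= (rho + theta) * (rho - theta) * theta by rewrite !mulr_ge0; lra.
  by lra.
by rewrite ler_pM2r//; lra.
Qed.

Lemma cone_params_le8 : cone_params theta rho N -> N <= 1 / 8.
Proof.
by move=> /cone_params_le_rho; have := sqr_ge0 (rho - 1/2); lra.
Qed.

(** It remains to maximize [theta ^+ 2 * (1 - theta)], and the square vanishes at the maximizer 2/3.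
    The next three bounds follow the same pattern, with a square centred at or near the maximizer in
    [rho]. *)
Lemma cone_params_theta : cone_params theta rho N -> N * theta <= 2 / 27.
Proof.
move=> h; have [t0 tr r1 NE] := h.
have := ler_wpM2r (ltW t0) (cone_params_le_theta h).
have : 0 <= (theta - 2 / 3) ^+ 2 * (theta + 1 / 3).
  by rewrite mulr_ge0 ?sqr_ge0//; lra.
lra.
Qed.

Lemma cone_params_kappa : cone_params theta rho N -> N * (rho * theta) <= 1 / 18.
Proof.
move=> h; have [t0 tr r1 NE] := h.
have h1 : N * (rho * theta) <= N * (rho * rho).
  by rewrite ler_wpM2l ?(ltW (cone_params_gt0 h))// ler_wpM2l//; lra.
have h2 : N * (rho * rho) <= rho * (1 - rho) / 2 * (rho * rho).
  by rewrite ler_wpM2r ?cone_params_le_rho// mulr_ge0; lra.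
have : 0 <= (rho - 3 / 4) ^+ 2 * ((rho + 1 / 4) ^+ 2 + 1 / 8).
  by rewrite mulr_ge0 ?sqr_ge0 ?addr_ge0 ?sqr_ge0//; lra.
lra.
Qed.

Lemma cone_params_sum : cone_params theta rho N -> N * (theta + rho) <= 1 / 6.
Proof.
move=> h; have [t0 tr r1 NE] := h.
have h1 : N * (theta + rho) <= N * (rho + rho).
  by rewrite ler_wpM2l ?(ltW (cone_params_gt0 h))//; lra.
have h2 : N * (rho + rho) <= rho * (1 - rho) / 2 * (rho + rho).
  by rewrite ler_wpM2r ?cone_params_le_rho//; lra.
have : 0 <= (rho - 2 / 3) ^+ 2 * (rho + 1 / 3) by rewrite mulr_ge0 ?sqr_ge0//; lra.
lra.
Qed.

Lemma cone_params_prod :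
  cone_params theta rho N -> N * ((1 + theta) * (1 + rho)) <= 1 / 3.
Proof.
move=> [t0 tr r1 NE].
have -> : N * ((1 + theta) * (1 + rho)) = theta * ((1 - rho ^+ 2) * (1 + rho)) / 2.
  have h0 : N * (1 + theta) = theta * (1 - rho ^+ 2) / 2 by lra.
  by rewrite mulrA h0; ring.
have h1 : theta * ((1 - rho ^+ 2) * (1 + rho)) <= rho * ((1 - rho ^+ 2) * (1 + rho)).
  rewrite ler_wpM2r//.
  have -> : (1 - rho ^+ 2) * (1 + rho) = (1 - rho) * (1 + rho) ^+ 2 by ring.
  by rewrite mulr_ge0 ?sqr_ge0// subr_ge0 ltW.
(* 16/25 approximates the maximizer [(1 + sqrt 17) / 8] of [rho * (1 - rho) * (1 + rho) ^+ 2]. *)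
have : 0 <= (rho - 16 / 25) ^+ 2 * (rho ^+ 2 + 57 / 25 * rho + 3 / 2).
  by rewrite mulr_ge0 ?sqr_ge0 ?addr_ge0 ?sqr_ge0//; lra.
by have := sqr_ge0 rho; lra.
Qed.

(** In the first step [T] is at least [1 - rho * theta], so this bounds [N] by [T / 4] even when [T]
    is small. *)
Lemma cone_params_compl :
  cone_params theta rho N -> N <= (1 - rho * theta) / 4.
Proof.
move=> h; have [t0 tr r1 NE] := h.
have h1 : 0 < 1 + theta by lra.
suff : N * (1 + theta) <= (1 - rho * theta) / 4 * (1 + theta) by rewrite ler_pM2r.
have : 0 <= (1 - theta) * (1 - rho ^+ 2) by rewrite mulr_ge0; nra.
have : 0 <= rho * (rho - theta) * (1 + theta) by rewrite !mulr_ge0; lra.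
lra.
Qed.

End ConeParams.

(** * Scalar recursions for a single Newton step *)

Section StepBounds.
Variable R : realFieldType.
Implicit Types N k s nu T g u ag a : R.

Lemma first_y_bound N g : N <= 1 / 8 ->
  0 <= g -> g <= N * (1 / 2 + g) -> g <= 4 / 7 * N.
Proof.
move=> N8 g0 hg.
have := ler_wpM2r g0 N8; lra.
Qed.

(* The contexts below are large, so [lra] is given only the listed facts. *)
Tactic Notation "lra_by" hyp_list(hs) := revert hs; clear; lra.

(* The units are those in which the initial error has phi-component 1.  Here k
   and s stand for rho theta and theta + rho; ag, a' are the phi-components and
   g, u the scaled range components of the errors of y_0 and x_1; and
   T = 1 - b(e_0)^2. *)
Lemma first_x_bound N k s nu T g u ag a' :
  0 < N -> N <= 1 / 8 -> N * k <= 1 / 18 -> N * s <= 1 / 6 ->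
  N <= (1 - k) / 4 -> 0 <= k -> k <= 1 -> 0 <= s -> s <= 2 ->
  0 <= nu -> nu <= N -> 1 - k <= T -> T <= 1 ->
  0 <= g -> g <= 4 / 7 * N -> 0 <= u ->
  `|ag - T / 2| <= k * g ->
  `|a' * (1 + ag) - T / 2| <= k * ((1 + g) * u) ->
  u <= nu / 2 * (s * (g * (1 + u) + u) + `|ag - a'|
                 + (1 + ag) * u + `|1 - a'| * g) ->
  [/\ 0 < ag, g <= ag, 0 < a' & a' <= 2 / 5] /\
  [/\ a' <= 3 / 5 * ((1 + ag) / 2), u <= 3 * N * a' & ag <= 3 / 5].
Proof.
move=> N0 N8 Nk Ns Nc k0 k1 s0 s2 nu0 nuN T0 T1 g0 gN u0 hag ha' hu.
have T_gt0 : 0 < T by lra_by T0 N0 Nc.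
have gT : g <= T / 7 by lra_by gN Nc T0.
have g14 : g <= 1 / 14 by lra_by gN N8.
have kgT : k * g <= T / 7 by rewrite (le_trans _ gT)// ler_piMl.
have kg : k * g <= 2 / 63.
  have := ler_wpM2l k0 gN; lra_by Nk.
have {hag} [ag1 ag2] : T / 2 - k * g <= ag /\ ag <= T / 2 + k * g.
  by move: hag; rewrite ler_norml => /andP[]; clear; split; lra.
have gu : g * u <= u / 14 by have := ler_wpM2r u0 g14; clear; lra.
have gu0 : 0 <= g * u by rewrite mulr_ge0.
have ku : k * u <= u by rewrite ler_piMl.
have ku0 : 0 <= k * u by rewrite mulr_ge0.
(* [w] bounds the perturbation of [a' * (1 + ag)]. It is kept as a multiple of [k * u]: once [u] is
   of order [N * T], [N * k <= 1 / 18] makes it a fraction of [T]. *)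
have [w [wE w0 wk]] : exists w,
    [/\ w = k * ((1 + g) * u), 0 <= w & w <= 15 / 14 * (k * u)].
  exists (k * ((1 + g) * u)); split=> //.
    by rewrite !mulr_ge0// addr_ge0.
  have : k * (g * u) <= k * (u / 14) by rewrite ler_wpM2l.
  by clear; lra.
have wu : w <= 15 / 14 * u by lra_by wk ku.
rewrite -wE {wE} in ha'.
have {ha'} [a1 a2] : T / 2 - w <= a' * (1 + ag) /\ a' * (1 + ag) <= T / 2 + w.
  by move: ha'; rewrite ler_norml => /andP[]; clear; split; lra.
have ag_ge : 5 / 14 * T <= ag by lra_by ag1 kgT.
have ag_le : ag <= 9 / 14 * T by lra_by ag2 kgT.
have ag_le1 : ag <= 67 / 126 by lra_by ag2 kg T1.
have ag0 : 0 < ag by lra_by ag_ge T_gt0.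
have ag2T : ag * ag <= 343 / 1000 * T.
  have := ler_wpM2r (ltW ag0) ag_le.
  have := ler_wpM2l (ltW T_gt0) ag_le1.
  by lra_by T_gt0.
have agag0 : 0 <= ag * ag by rewrite mulr_ge0 ?ltW.
have D1 : 1 <= 1 + ag by lra_by ag0.
have D0 : 0 < 1 + ag by lra_by ag0.
(* Only [a' * (1 + ag)] is controlled, so distances to [a'] are first estimated after multiplication
   by [1 + ag >= 1]. *)
have dag : `|ag - a'| <= 486 / 1000 * T + w.
  have : `|ag - a'| * (1 + ag) <= 486 / 1000 * T + w.
    rewrite -{1}(gtr0_norm D0) -normrM ler_norml.
    by apply/andP; split; lra_by a1 a2 ag1 ag2 kgT ag2T agag0 w0 T_gt0.
  by apply: le_trans; rewrite ler_peMr.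
have d1 : `|1 - a'| <= 104 / 100 + w.
  have : `|1 - a'| * (1 + ag) <= 104 / 100 + w.
    rewrite -{1}(gtr0_norm D0) -normrM ler_norml.
    by apply/andP; split; lra_by a1 a2 ag1 ag2 kg w0 T_gt0 T1.
  by apply: le_trans; rewrite ler_peMr.
have uN : u <= N / 2 * (s * (g * (1 + u) + u)
    + (486 / 1000 * T + w) + (1 + ag) * u + (104 / 100 + w) * g).
  apply: (le_trans hu); apply: ler_pM.
  - by rewrite divr_ge0.
  - by rewrite !addr_ge0 ?mulr_ge0 ?addr_ge0 ?mulr_ge0 ?addr_ge0// ltW.
  - by lra_by nuN.
  - by rewrite lerD ?ler_wpM2r// !lerD.
(* The products are split so that the terms in [u] have total coefficient below 3/10 in [uN] and can
   be absorbed; the rest is a multiple of [N * T]. *)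
have e1 : N * (s * g) <= 2 / 7 * (N * T).
  have h1 : s * g <= 2 * (T / 7) by apply: ler_pM.
  by have := ler_wpM2l (ltW N0) h1; clear; lra.
have e2 : N * s * ((1 + g) * u) <= 1 / 6 * (15 / 14 * u).
  apply: ler_pM; rewrite ?mulr_ge0 ?addr_ge0 ?(ltW N0)//.
  by lra_by gu.
have e3 : N * w <= 1 / 8 * (15 / 14 * u) by apply: ler_pM; rewrite // ltW.
have e4 : N * ((1 + ag) * u) <= 1 / 8 * (154 / 100 * u).
  apply: ler_pM; rewrite ?mulr_ge0 ?(ltW N0) ?(ltW D0)// ler_wpM2r//.
  by lra_by ag_le1.
have e5 : N * g <= 1 / 7 * (N * T).
  by have := ler_wpM2l (ltW N0) gT; clear; lra.
have e6 : N * w * g <= 1 / 8 * (15 / 14 * u) * (1 / 14).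
  by apply: ler_pM; rewrite // mulr_ge0 ?(ltW N0).
have uT : u <= 62 / 100 * (N * T).
  by have := mulr_gt0 N0 T_gt0; lra_by uN e1 e2 e3 e4 e5 e6 u0.
have kuT : k * u <= 62 / 100 * (1 / 18 * T).
  have := ler_wpM2r (ltW T_gt0) Nk.
  by have := ler_wpM2l k0 uT; clear; lra.
have ha0 : 462 / 1000 * T <= a' * (1 + ag) by lra_by a1 wk kuT T_gt0.
have ha1 : a' * (1 + ag) <= 537 / 1000 * T by lra_by a2 wk kuT T_gt0.
(* A lower bound proportional to [T], like the upper bound on [u]: comparing the two gives
   [u <= 3 * N * a'] however small [T] is. *)
have la : 300 / 1000 * T <= a'.
  rewrite -(ler_pM2r D0) (le_trans _ ha0)//.
  by have := ler_wpM2l (ltW T_gt0) ag_le1; lra_by T_gt0.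
split; split=> //.
- by lra_by gT ag_ge T_gt0.
- by lra_by la T_gt0.
- by rewrite -(ler_pM2r D0); lra_by ha1 ag_ge T1.
(* The square linearizes [ag ^+ 2] near 5/14, the lower bound of [ag] when [T = 1]. *)
- by rewrite -(ler_pM2r D0); have := sqr_ge0 (ag - 357 / 1000); lra_by ha1 ag_ge T1.
- by have := ler_wpM2l (ltW N0) la; have := mulr_gt0 N0 T_gt0; lra_by uT.
- by lra_by ag_le1.
Qed.

(* Here a, az, ag are the phi-components and p, pz, g the scaled range components
   of the errors of x_k, z_(k-1), y_k, for k >= 1. *)
Lemma later_y_bound N k s nu a az p pz g ag :
  0 < N -> N <= 1 / 8 -> N * k <= 1 / 18 -> N * (1 + s + k) <= 1 / 3 ->
  0 <= k -> 0 <= s -> 0 <= nu -> nu <= N ->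
  0 < a -> a <= 2 / 5 -> a <= 3 / 5 * az -> az <= 4 / 5 ->
  0 <= pz -> pz <= az -> 0 <= p -> p <= 3 * N * a -> 0 <= g ->
  `|az * (a - ag) - a ^+ 2 / 2| <= k * (pz * (p + g) + p ^+ 2 / 2) ->
  g <= nu * (s * (pz * (p + g) + p ^+ 2 / 2) + `|az - a| * p + az * g
             + `|a - ag| * pz) ->
  [/\ g <= 8 / 5 * N * a, 21 / 50 * a <= ag,
      ag <= (1 + 5 * (N * k)) * a & ag <= 103 / 250].
Proof.
move=> N0 N8 Nk N3 k0 s0 nu0 nuN a0 a1 aaz az1 pz0 pzaz p0 pN g0 hag hg.
have az0 : 0 < az by lra_by a0 aaz.
have Na0 : 0 < N * a by rewrite mulr_gt0.
have pa : p <= 3 / 8 * a by have := ler_wpM2r (ltW a0) N8; lra_by pN.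
have paz : p <= 9 / 40 * az by lra_by pa aaz.
(* 89/80 is 1 + 9/80: since [p <= 9 / 40 * az], the term [p ^+ 2 / 2] is at most
   [az * (9 / 80 * p)]. Thus [az] factors out of the whole perturbation. *)
have [q [qE q0 qp]] : exists q, [/\ q = 89 / 80 * p + g, 0 <= q & p + g <= q].
  by exists (89 / 80 * p + g); split; lra_by p0 g0.
have [S [SE S0 Sq]] : exists S,
    [/\ S = pz * (p + g) + p ^+ 2 / 2, 0 <= S & S <= az * q].
  exists (pz * (p + g) + p ^+ 2 / 2); split=> //.
    by rewrite addr_ge0 ?divr_ge0 ?mulr_ge0 ?addr_ge0 ?sqr_ge0.
  have h1 : pz * (p + g) <= az * (p + g) by rewrite ler_wpM2r// addr_ge0.
  have := ler_wpM2l p0 paz; rewrite qE; lra_by h1.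
rewrite -SE {SE} in hag hg.
have kq0 : 0 <= k * q by rewrite mulr_ge0.
have kS : k * S <= az * (k * q) by have := ler_wpM2l k0 Sq; clear; lra.
have {hag} [d1 d2] : a ^+ 2 / 2 - k * S <= az * (a - ag) /\
    az * (a - ag) <= a ^+ 2 / 2 + k * S.
  by move: hag; rewrite ler_norml => /andP[]; clear; split; lra.
have a2 : a ^+ 2 / 2 <= az * (3 / 10 * a).
  by have := ler_wpM2l (ltW a0) aaz; clear; lra.
have a3 : az * (5 / 8 * a ^+ 2) <= a ^+ 2 / 2.
  by have := ler_wpM2r (sqr_ge0 a) az1; clear; lra.
have dU : a - ag <= 3 / 10 * a + k * q.
  by rewrite -(ler_pM2l az0); lra_by d2 a2 kS.
have dL : 5 / 8 * a ^+ 2 - k * q <= a - ag.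
  by rewrite -(ler_pM2l az0); lra_by d1 a3 kS.
have dd : `|a - ag| <= 3 / 10 * a + k * q.
  rewrite ler_norml; apply/andP; split=> //.
  by have := sqr_ge0 a; lra_by dL a0.
have dz : `|az - a| <= az by rewrite ler_norml; apply/andP; split; lra_by a0 aaz.
have hg2 : g <= N * (az * ((1 + s + k) * q + 3 / 10 * a)).
  apply: (le_trans hg); apply: ler_pM => //.
    by rewrite !addr_ge0 ?mulr_ge0 ?(ltW az0).
  have h1 : s * S <= s * (az * q) by rewrite ler_wpM2l.
  have h2 : `|az - a| * p <= az * p by rewrite ler_wpM2r.
  have h3 : `|a - ag| * pz <= (3 / 10 * a + k * q) * az by apply: ler_pM.
  have h4 : az * (p + g) <= az * q by rewrite ler_wpM2l ?(ltW az0).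
  by lra_by h1 h2 h3 h4.
(* [az <= 4 / 5] and [N * (1 + s + k) <= 1 / 3] leave the [g] inside [q] with coefficient 4/15,
   which can be absorbed. *)
have hg3 : g <= 4 / 5 * (1 / 3 * q + 3 / 10 * (N * a)).
  have h1 : az * (N * ((1 + s + k) * q + 3 / 10 * a)) <=
            4 / 5 * (N * ((1 + s + k) * q + 3 / 10 * a)).
    have h0 : 0 <= 1 + s + k by lra_by s0 k0.
    have h3 := mulr_ge0 h0 q0.
    by rewrite ler_wpM2r// mulr_ge0 ?(ltW N0)//; lra_by h3 a0.
  have := ler_wpM2r q0 N3; lra_by h1 hg2.
have gN : g <= 8 / 5 * N * a by rewrite qE in hg3; lra_by hg3 pN Na0.
have kq : k * q <= 5 * (N * k) * a.
  have h1 : q <= 5 * (N * a) by rewrite qE; lra_by gN pN Na0.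
  by have := ler_wpM2l k0 h1; clear; lra.
have kq2 : k * q <= 2744 / 10000 * a.
  have h1 : q <= 4938 / 1000 * (N * a) by rewrite qE; lra_by gN pN Na0.
  have h2 := ler_wpM2l k0 h1; have h3 := ler_wpM2r (ltW a0) Nk.
  by lra_by h2 h3 a0.
split=> //.
- by lra_by dU kq2 a0.
- by have := sqr_ge0 a; lra_by dL kq.
(* [a ^+ 2] is linearized at 2/5, the end of the range of [a], where the upper bound on [ag] is
   largest. *)
- by have := sqr_ge0 (a - 2 / 5); lra_by dL kq2 a1.
Qed.

(** The letters are as above, with [a'] and [u] for the error of x_(k+1). Unperturbed, [a'] would be
    [m = a * ag / (a + ag)], at most [(a + ag) / 4] by the arithmetic-geometric inequality, hence
    about [a / 2]. The excess is controlled by [N * k * a] and [u], thus by multiples of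
    [theta * a], and fits into [theta / 2 * a]. *)
Lemma later_x_bound N k s nu theta a p g ag u a' :
  0 < N -> N <= 1 / 8 -> N * k <= 1 / 18 -> N * s <= 1 / 6 -> N <= theta / 2 ->
  0 <= k -> k <= theta -> theta <= 1 -> 0 <= s -> 0 <= nu -> nu <= N ->
  0 < a -> a <= 2 / 5 -> 0 <= p -> p <= 3 * N * a ->
  0 <= g -> g <= 8 / 5 * N * a -> 21 / 50 * a <= ag ->
  ag <= (1 + 5 * (N * k)) * a -> 0 <= u ->
  `|a' * (a + ag) - ag * a| <= k * (g * (p + u) + p * u) ->
  u <= nu / 2 * (s * (g * (p + u) + p * u) + `|ag - a'| * p
                 + (a + ag) * u + `|a - a'| * g) ->
  [/\ 0 < a', a' <= 2 / 5 & a' <= 3 / 5 * ((a + ag) / 2)] /\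
  u <= 3 * N * a' /\ a' + theta * u <= (1 + theta) / 2 * a.
Proof.
move=> N0 N8 Nk Ns Nt k0 kt t1 s0 nu0 nuN a0 a1 p0 pN g0 gN ag1 ag2 u0 ha' hu.
have Na0 : 0 < N * a by rewrite mulr_gt0.
have Na8 : N * a <= 1 / 8 * a by rewrite ler_pM2r.
have pa : p <= 3 / 8 * a by lra_by pN Na8.
have ga : g <= 1 / 5 * a by lra_by gN Na8.
have Nka := ler_wpM2r (ltW a0) Nk.
have Nka0 : 0 <= N * k * a by rewrite !mulr_ge0 ?(ltW N0) ?(ltW a0).
have ag3 : ag <= 23 / 18 * a by lra_by ag2 Nka.
have [D [DE D0 D1 D2]] : exists D,
    [/\ D = a + ag, 0 < D, 142 / 100 * a <= D & D <= 41 / 18 * a].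
  by exists (a + ag); split; lra_by ag1 ag3 a0.
rewrite -DE in ha' hu *.
have [m mE] : exists m, m * D = ag * a by exists (ag * a / D); rewrite divfK ?gt_eqF.
have m_le : m <= D / 4.
  by rewrite -(ler_pM2r D0) mE; have := sqr_ge0 (a - ag); rewrite DE; clear; lra.
have m_ge : 2957 / 10000 * a <= m.
  rewrite -(ler_pM2r D0) mE.
  by have := sqr_ge0 a; have := ler_wpM2r (ltW a0) ag1; rewrite DE; clear; lra.
have m_le2 : m <= 5611 / 10000 * a.
  rewrite -(ler_pM2r D0) mE.
  by have := sqr_ge0 a; have := ler_wpM2r (ltW a0) ag3; rewrite DE; clear; lra.
(* [ag - m] equals [ag ^+ 2 / D]. *)
have agm0 : 0 <= ag - m.
  rewrite -(pmulr_lge0 _ D0) mulrBl mE DE.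
  by have := sqr_ge0 ag; clear; lra.
have agm1 : ag - m <= 718 / 1000 * a.
  rewrite -(ler_pM2r D0) mulrBl mE.
  have h1 : ag * ag <= ag * (23 / 18 * a).
    by rewrite ler_wpM2l//; lra_by ag1 a0.
  have h2 := ler_wpM2r (ltW a0) ag3.
  by have := sqr_ge0 a; rewrite DE; lra_by h1 h2.
have [S [SE S0 S1]] : exists S, [/\ S = g * (p + u) + p * u, 0 <= S &
    S <= 24 / 100 * (N * a) + 23 / 100 * u].
  exists (g * (p + u) + p * u); split=> //.
    by rewrite addr_ge0 ?mulr_ge0 ?addr_ge0.
  have h1 : g * p <= 8 / 5 * N * a * (3 / 8 * (2 / 5)).
    by apply: ler_pM => //; lra_by pa a1.
  have h2 : (g + p) * u <= 23 / 100 * u by rewrite ler_wpM2r//; lra_by ga pa a1.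
  by lra_by h1 h2.
rewrite -SE in ha' hu.
have kS : k * S <= a * (6 / 10 * (N * k * a) + 256 / 1000 * u).
  have h1 : g * p <= 8 / 5 * N * a * (3 / 8 * a) by apply: ler_pM.
  have h2 := ler_wpM2l k0 h1.
  have h3 : (g + p) * u <= 23 / 5 * (N * a) * u by rewrite ler_wpM2r//; lra_by gN pN.
  have h4 := ler_wpM2l k0 h3.
  have h5 := ler_wpM2r (mulr_ge0 (ltW a0) u0) Nk.
  have h6 : 0 <= a * u by rewrite mulr_ge0// ltW.
  by rewrite SE; lra_by h2 h4 h5 h6.
have dm : `|a' - m| <= 4226 / 10000 * (N * k * a) + 1803 / 10000 * u.
  rewrite -(ler_pM2r D0) -{1}(gtr0_norm D0) -normrM mulrBl mE (le_trans ha')//.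
  rewrite (le_trans kS)//.
  have h1 : 0 <= 6 / 10 * (N * k * a) + 256 / 1000 * u by lra_by Nka0 u0.
  have h2 := ler_wpM2r h1 D1.
  have h3 := mulr_ge0 (ltW D0) Nka0; have h4 := mulr_ge0 (ltW D0) u0.
  by lra_by h2 h3 h4.
move: (dm); rewrite ler_norml => /andP[dm1 dm2].
have daa : `|a - a'| <= 73 / 100 * a + 19 / 100 * u.
  by rewrite ler_norml; apply/andP; split; lra_by dm1 dm2 m_ge m_le2 Nka u0 a0.
have dga : `|ag - a'| <= 75 / 100 * a + 19 / 100 * u.
  by rewrite ler_norml; apply/andP; split; lra_by dm1 dm2 agm0 agm1 Nka u0 a0.
have hu2 : u <= N / 2 * (s * S + (75 / 100 * a + 19 / 100 * u) * p
    + D * u + (73 / 100 * a + 19 / 100 * u) * g).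
  apply: (le_trans hu); apply: ler_pM.
  - by rewrite divr_ge0.
  - by rewrite !addr_ge0 ?mulr_ge0// ltW.
  - by lra_by nuN.
  - by rewrite !lerD ?ler_wpM2r.
have e1 : N * s * S <= 1 / 6 * (24 / 100 * (N * a) + 23 / 100 * u).
  by apply: ler_pM; rewrite ?mulr_ge0 ?(ltW N0).
have Na0' := ltW Na0.
have e2 : N * (a * p) <= 1 / 8 * (2 / 5 * (3 * (N * a))).
  apply: ler_pM; rewrite ?(ltW N0) ?mulr_ge0 ?(ltW a0)//.
  by apply: ler_pM; rewrite ?(ltW a0)//; lra_by pN.
have e3 : N * (a * g) <= 1 / 8 * (2 / 5 * (8 / 5 * (N * a))).
  apply: ler_pM; rewrite ?(ltW N0) ?mulr_ge0 ?(ltW a0)//.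
  by apply: ler_pM; rewrite ?(ltW a0)//; lra_by gN.
have e4 : N * (u * (p + g)) <= 1 / 8 * (u * (23 / 100)).
  apply: ler_pM; rewrite ?(ltW N0) ?mulr_ge0 ?addr_ge0//.
  by rewrite ler_wpM2l//; lra_by pa ga a1.
have e5 : N * (D * u) <= 1 / 8 * (92 / 100 * u).
  apply: ler_pM; rewrite ?(ltW N0) ?mulr_ge0 ?(ltW D0)//.
  by rewrite ler_wpM2r//; lra_by D2 a1.
have uN : u <= 12 / 100 * (N * a) by lra_by hu2 e1 e2 e3 e4 e5 Na0 u0.
have la : 269 / 1000 * a <= a' by lra_by dm1 m_ge Nka uN Na8 a0.
split; split.
- by lra_by la a0.
- by lra_by dm2 m_le2 Nka uN Na8 a1.
- by lra_by dm2 m_le Nka uN Na8 D1 a0.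
- by have := ler_wpM2l (ltW N0) la; lra_by uN Na0.
have h1 : N * (k * a) <= 1 / 8 * (theta * a).
  apply: ler_pM; rewrite ?(ltW N0) ?mulr_ge0 ?(ltW a0)//.
  by rewrite ler_wpM2r// ltW.
have h2 := ler_wpM2r (ltW a0) Nt.
have t0 : 0 <= theta by lra_by k0 kt.
have h3 : theta * u <= theta * (12 / 100 * (1 / 8 * a)).
  by rewrite ler_wpM2l//; lra_by uN Na8.
have h4 : 0 <= theta * a by rewrite mulr_ge0// ltW.
by rewrite DE in m_le; lra_by dm2 m_le h1 h2 h3 h4 uN ag2.
Qed.

End StepBounds.

(** * Norms and bilinear maps *)

Section Norm.
Variables (R : realType) (m : nat) (nrm : 'rV[R]_m -> R).
Hypothesis nrmP : is_norm nrm.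
Implicit Types (x y h k : 'rV[R]_m) (A : 'M[R]_m).

Lemma nrmZ (a : R) x : nrm (a *: x) = `|a| * nrm x.
Proof. exact: norm_homogeneous nrmP a x. Qed.

Lemma nrmD x y : nrm (x + y) <= nrm x + nrm y.
Proof. exact: norm_triangle nrmP x y. Qed.

Lemma nrm0 : nrm 0 = 0.
Proof. by rewrite -(scale0r 0) nrmZ normr0 mul0r. Qed.

Lemma nrmN x : nrm (- x) = nrm x.
Proof. by rewrite -scaleN1r nrmZ normrN normr1 mul1r. Qed.

Lemma nrmB x y : nrm (x - y) <= nrm x + nrm y.
Proof. by rewrite -[nrm y]nrmN nrmD. Qed.

Lemma nrm_ge0 x : 0 <= nrm x.
Proof.
have := nrmB x x; rewrite subrr nrm0 -mulr2n -[_ *+ 2]mulr_natl.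
by rewrite pmulr_rge0// ltr0n.
Qed.

Lemma nrm_gt0 x : x != 0 -> 0 < nrm x.
Proof.
move=> x0; rewrite lt_neqAle nrm_ge0 andbT eq_sym.
by apply: contra_neq x0; exact: norm_definite nrmP x.
Qed.

Lemma nrm_sum (I : finType) (P : pred I) (F : I -> 'rV[R]_m) :
  nrm (\sum_(i | P i) F i) <= \sum_(i | P i) nrm (F i).
Proof.
elim/big_ind2: _ => //; first by rewrite nrm0.
by move=> x1 x2 y1 y2 h1 h2; rewrite (le_trans (nrmD _ _))// lerD.
Qed.

Lemma nrm_le_coord x : nrm x <= \sum_i `|x 0 i| * nrm (delta_mx 0 i).
Proof.
rewrite {1}[x]row_sum_delta (le_trans (nrm_sum _ _))//.
by apply: ler_sum => i _; rewrite nrmZ.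
Qed.

Lemma coord_le_mx_norm x i : `|x 0 i| <= `|x|.
Proof.
rewrite -[leRHS]/(mx_norm x) mx_normrE.
exact: (le_bigmax _ (fun i : 'I_1 * 'I_m => `|x i.1 i.2|) (0, i)).
Qed.

Lemma nrm_le_mx_norm : exists2 C : R, 0 <= C & forall x, nrm x <= C * `|x|.
Proof.
exists (\sum_i nrm (delta_mx 0 i)); first by apply: sumr_ge0 => i _; exact: nrm_ge0.
move=> x; rewrite (le_trans (nrm_le_coord x))// mulr_suml ler_sum// => i _.
by rewrite mulrC ler_wpM2l ?nrm_ge0 ?coord_le_mx_norm.
Qed.

Lemma nrm_continuous : continuous nrm.
Proof.
have [C C0 hC] := nrm_le_mx_norm.
move=> x; apply/(@cvgrPdist_le _ _ _ _ (nbhs_filter x)) => /= e e0.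
near=> y.
have h1 : `|nrm x - nrm y| <= nrm (x - y).
  rewrite ler_norml; apply/andP; split.
    rewrite lerNl opprB lerBlDr (_ : nrm (x - y) = nrm (y - x)).
      by rewrite -{1}(subrK x y) nrmD.
    by rewrite -nrmN opprB.
  by rewrite lerBlDr -{1}(subrK y x) nrmD.
rewrite (le_trans h1)// (le_trans (hC _))//.
have : `|x - y| <= e / (C + 1).
  near: y; apply: cvgr_dist_le; first exact: cvg_id.
  by rewrite divr_gt0// ltr_wpDl.
move=> h2; rewrite (@le_trans _ _ ((C + 1) * `|x - y|))//.
  by rewrite ler_wpM2r// lerDl.
by rewrite mulrC -ler_pdivlMr// ltr_wpDl.
Unshelve. all: by end_near. Qed.

(** Equivalence of norms: [nrm] is continuous and attains a positive minimum on the compact unit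
    sphere of the library norm. The sphere is empty in the zero space, hence the case split. *)
Lemma mx_norm_le_nrm : exists2 C : R, 0 < C & forall x, `|x| <= C * nrm x.
Proof.
have [[x0 x0N]|x00] := pselect (exists x : 'rV[R]_m, x != 0); last first.
  exists 1 => // x; rewrite mul1r.
  have -> : x = 0 by apply/eqP/negPn/negP => xN; apply: x00; exists x.
  by rewrite normr0 nrm_ge0.
pose S := [set x : 'rV[R]_m | `|x| = 1].
have S0 : S !=set0.
  exists (`|x0|^-1 *: x0); rewrite /S/= normrZ normfV normr_id mulVf//.
  by rewrite normr_eq0.
have cS : compact S.
  apply: bounded_closed_compact.
    exists 1; split; first exact: num_real.
    by move=> M M1 x /= ->; exact: ltW.
  have -> : S = (fun x : 'rV[R]_m => `|x|) @^-1` [set 1] by [].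
  by apply: preimage_closed; [move=> x _; exact: norm_continuous|exact: closed_eq].
have [c cS1 hc] := EVT_min_rV S0 cS (continuous_subspaceT nrm_continuous).
have c1 : `|c| = 1 by move: cS1; rewrite inE.
have c0 : c != 0 by rewrite -normr_eq0 c1 oner_neq0.
have nc := nrm_gt0 c0.
exists (nrm c)^-1; first by rewrite invr_gt0.
move=> x; have [->|xN] := eqVneq x 0; first by rewrite normr0 nrm0 mulr0.
have nx : 0 < `|x| by rewrite normr_gt0.
have : nrm c <= nrm (`|x|^-1 *: x).
  by apply: hc; rewrite inE /S/= normrZ normfV normr_id mulVf// gt_eqF.
rewrite nrmZ normfV normr_id => h.
by rewrite ler_pdivlMl// mulrC -ler_pdivlMl// mulrC.
Qed.

Definition bilinear_map (b : 'rV[R]_m -> 'rV[R]_m -> 'rV[R]_m) :=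
  (forall (a : R) h h' k, b (a *: h + h') k = a *: b h k + b h' k) /\
  (forall (a : R) h k k', b h (a *: k + k') = a *: b h k + b h k').

Lemma nrm_mulmx_bounded A :
  exists2 C : R, 0 <= C & forall x, nrm (x *m A) <= C * nrm x.
Proof.
have [C C0 hC] := mx_norm_le_nrm.
exists (\sum_i C * nrm (delta_mx 0 i *m A)).
  by apply: sumr_ge0 => i _; rewrite mulr_ge0 ?nrm_ge0 ?ltW.
move=> x; rewrite {1}[x]row_sum_delta mulmx_suml (le_trans (nrm_sum _ _))// mulr_suml.
apply: ler_sum => i _; rewrite -scalemxAl nrmZ mulrAC ler_wpM2r ?nrm_ge0//.
by rewrite (le_trans (coord_le_mx_norm x i)).
Qed.

(** [sup] is an upper bound only of a set that is bounded above, which [nrm_mulmx_bounded] supplies;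
    the rest is normalization of [x]. *)
Lemma opnorm_le A x : nrm (x *m A) <= opnorm nrm A * nrm x.
Proof.
have [C C0 hC] := nrm_mulmx_bounded A.
have [->|xN] := eqVneq x 0; first by rewrite mul0mx nrm0 mulr0.
have nx := nrm_gt0 xN.
rewrite -ler_pdivrMr//.
have -> : nrm (x *m A) / nrm x = nrm (((nrm x)^-1 *: x) *m A).
  by rewrite -scalemxAl nrmZ ger0_norm ?invr_ge0 ?nrm_ge0// mulrC.
apply: ub_le_sup.
  exists C => _ [h /= h1 <-]; rewrite (le_trans (hC h))//.
  by rewrite ler_piMr.
exists ((nrm x)^-1 *: x) => //=.
by rewrite nrmZ ger0_norm ?invr_ge0 ?nrm_ge0// mulVf// gt_eqF.
Qed.

Section Bilinear.
Variable b : 'rV[R]_m -> 'rV[R]_m -> 'rV[R]_m.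
Hypothesis bP : bilinear_map b.

Lemma bilinDl h h' k : b (h + h') k = b h k + b h' k.
Proof. by have := bP.1 1 h h' k; rewrite !scale1r. Qed.
Lemma bilinDr h k k' : b h (k + k') = b h k + b h k'.
Proof. by have := bP.2 1 h k k'; rewrite !scale1r. Qed.
Lemma bilin0l k : b 0 k = 0.
Proof. by apply: (addrI (b 0 k)); rewrite -bilinDl !addr0. Qed.
Lemma bilin0r h : b h 0 = 0.
Proof. by apply: (addrI (b h 0)); rewrite -bilinDr !addr0. Qed.
Lemma bilinZl a h k : b (a *: h) k = a *: b h k.
Proof. by have := bP.1 a h 0 k; rewrite bilin0l !addr0. Qed.
Lemma bilinZr a h k : b h (a *: k) = a *: b h k.
Proof. by have := bP.2 a h k 0; rewrite bilin0r !addr0. Qed.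
Lemma bilinNl h k : b (- h) k = - b h k.
Proof. by rewrite -scaleN1r bilinZl scaleN1r. Qed.
Lemma bilinNr h k : b h (- k) = - b h k.
Proof. by rewrite -scaleN1r bilinZr scaleN1r. Qed.
Lemma bilinBl h h' k : b (h - h') k = b h k - b h' k.
Proof. by rewrite bilinDl bilinNl. Qed.
Lemma bilinBr h k k' : b h (k - k') = b h k - b h k'.
Proof. by rewrite bilinDr bilinNr. Qed.

Lemma bilin_suml (I : finType) (F : I -> 'rV[R]_m) k :
  b (\sum_i F i) k = \sum_i b (F i) k.
Proof.
by apply: (big_morph (b^~ k)) => [x y|]; [exact: bilinDl|exact: bilin0l].
Qed.
Lemma bilin_sumr (I : finType) (F : I -> 'rV[R]_m) h :
  b h (\sum_i F i) = \sum_i b h (F i).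
Proof.
by apply: (big_morph (b h)) => [x y|]; [exact: bilinDr|exact: bilin0r].
Qed.

Lemma bilin_coord h k :
  b h k = \sum_i \sum_j (h 0 i * k 0 j) *: b (delta_mx 0 i) (delta_mx 0 j).
Proof.
rewrite {1}[h]row_sum_delta bilin_suml; apply: eq_bigr => i _.
rewrite bilinZl {1}[k]row_sum_delta bilin_sumr scaler_sumr.
by apply: eq_bigr => j _; rewrite bilinZr scalerA.
Qed.

Lemma nrm_bilin_bounded :
  exists2 C : R, 0 <= C & forall h k, nrm (b h k) <= C * (nrm h * nrm k).
Proof.
have [C C0 hC] := mx_norm_le_nrm.
pose S := \sum_i \sum_j nrm (b (delta_mx 0 i) (delta_mx 0 j)).
exists (C * C * S).
  rewrite mulr_ge0 ?mulr_ge0 ?(ltW C0)//.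
  by apply: sumr_ge0 => i _; apply: sumr_ge0 => j _; exact: nrm_ge0.
move=> h k; rewrite bilin_coord (le_trans (nrm_sum _ _))//.
rewrite mulrAC mulr_sumr; apply: ler_sum => i _.
rewrite (le_trans (nrm_sum _ _))// mulr_sumr; apply: ler_sum => j _.
rewrite nrmZ ler_wpM2r ?nrm_ge0// normrM mulrACA.
by apply: ler_pM => //; rewrite (le_trans (coord_le_mx_norm _ _)).
Qed.

Lemma bilin_opnorm_le h k : nrm (b h k) <= bilin_opnorm nrm b * (nrm h * nrm k).
Proof.
have [C C0 hC] := nrm_bilin_bounded.
have [->|hN] := eqVneq h 0; first by rewrite bilin0l nrm0 mul0r mulr0.
have [->|kN] := eqVneq k 0; first by rewrite bilin0r nrm0 !mulr0.
have nh := nrm_gt0 hN; have nk := nrm_gt0 kN.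
rewrite -ler_pdivrMr ?mulr_gt0//.
have n1 x : x != 0 -> nrm ((nrm x)^-1 *: x) = 1.
  move=> /nrm_gt0 x0.
  by rewrite nrmZ ger0_norm ?invr_ge0 ?nrm_ge0// mulVf// gt_eqF.
have -> : nrm (b h k) / (nrm h * nrm k)
    = nrm (b ((nrm h)^-1 *: h) ((nrm k)^-1 *: k)).
  rewrite bilinZl bilinZr scalerA nrmZ ger0_norm; last first.
    by rewrite mulr_ge0 ?invr_ge0 ?nrm_ge0.
  by rewrite mulrC invfM.
apply: ub_le_sup.
  exists C => _ [[h' k'] /= [h1 k1] <-]; rewrite (le_trans (hC _ _))//.
  by rewrite ler_piMr// mulr_ile1 ?nrm_ge0.
by exists ((nrm h)^-1 *: h, (nrm k)^-1 *: k) => //=; rewrite !n1.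
Qed.

End Bilinear.
End Norm.

(** * Newton steps at a singular root *)

(** Dividing by [theta] turns the cone condition of [Wset] into [relR <= |a|], with [a] the
    coordinate along the normalized kernel vector. *)
Definition relR (R : realType) (m : nat) (nrm : 'rV[R]_m -> R) (PR : 'M[R]_m)
  (theta : R) (h : 'rV[R]_m) := nrm (h *m PR) / theta.

Section SingularNewton.
Variables (R : realType) (m : nat) (nrm : 'rV[R]_m -> R).
Hypothesis nrmP : is_norm nrm.
Variables (A PN PR : 'M[R]_m) (F : 'rV[R]_m -> 'rV[R]_m -> 'rV[R]_m).
Variables (phi : 'rV[R]_m) (a b : {scalar 'rV[R]_m}).
Variables (theta rho N nu0 B K L : R).
Implicit Types (h k e g zeta : 'rV[R]_m).

Hypotheses (PN_E : forall h, h *m PN = a h *: phi) (PNR : PN + PR = 1%:M).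
Hypotheses (phi1 : nrm phi = 1) (a_phi : a phi = 1) (b_phi : b phi = 0).
Hypothesis a_A : forall h, a (h *m A) = 0.
Hypothesis phi_A : phi *m A = 0.
Hypothesis nu0_gt0 : 0 < nu0.
Hypothesis le_nu0 : forall k, a k = 0 -> nrm k <= nu0 * nrm (k *m A).
Hypotheses (F_bilin : bilinear_map F) (F_sym : forall h k, F h k = F k h).
Hypothesis K_neq0 : K != 0.
Hypothesis a_F : forall h k, a (F h k) = K * (a h * a k - b h * b k).
Hypothesis le_L : forall h k, `|a h * a k - b h * b k| <= L * (nrm h * nrm k).
Hypothesis B_gt0 : 0 < B.
Hypothesis le_B : forall h k, nrm (F h k) <= B * (nrm h * nrm k).
Hypothesis params : cone_params theta rho N.
Hypothesis rhoE : rho = L * theta.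

Let theta_gt0 : 0 < theta. Proof. by case: params. Qed.

Local Notation p := (relR nrm PR theta).

Lemma formB h k : a (h - k) = a h - a k.
Proof. exact: linearB. Qed.

Lemma mulmx_PR h : h *m PR = h - a h *: phi.
Proof. by rewrite -PN_E -[X in X - _]mulmx1 -PNR mulmxDr addrC addKr. Qed.

Lemma range_split h : h = a h *: phi + h *m PR.
Proof. by rewrite mulmx_PR addrC subrK. Qed.

Lemma relR_ge0 h : 0 <= p h.
Proof. by rewrite divr_ge0 ?(nrm_ge0 nrmP) ?ltW. Qed.

Lemma relRE h : nrm (h *m PR) = theta * p h.
Proof. by rewrite mulrC divfK ?gt_eqF. Qed.

Lemma relRD h k : p (h + k) <= p h + p k.
Proof. by rewrite -mulrDl ler_pM2r ?invr_gt0// mulmxDl nrmD. Qed.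

Lemma relRZ c h : p (c *: h) = `|c| * p h.
Proof. by rewrite /relR -scalemxAl nrmZ// mulrA. Qed.

Lemma relRB h k : p (h - k) <= p h + p k.
Proof. by rewrite (le_trans (relRD _ _))// -scaleN1r relRZ normrN normr1 mul1r. Qed.

Lemma a_PR h : a (h *m PR) = 0.
Proof. by rewrite mulmx_PR linearB linearZ/= a_phi mulr1 subrr. Qed.

Lemma b_PR h : b (h *m PR) = b h.
Proof. by rewrite mulmx_PR linearB linearZ/= b_phi mulr0 subr0. Qed.

Lemma norm_phiZ c : nrm (c *: phi) = `|c|.
Proof. by rewrite nrmZ// phi1 mulr1. Qed.

Lemma norm_le_split h : nrm h <= `|a h| + theta * p h.
Proof. by rewrite {1}(range_split h) (le_trans (nrmD nrmP _ _))// norm_phiZ relRE. Qed.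

Lemma split_le_norm h : `|a h| <= nrm h + theta * p h.
Proof.
rewrite -norm_phiZ -relRE (_ : a h *: phi = h - h *m PR); first exact: nrmB.
by rewrite [X in X - _]range_split addrK.
Qed.

(** [b] sees only range components, and [a] vanishes on them, so there [le_L] is a bound on [b]
    alone. *)
Lemma le_bb h k : `|b h * b k| <= rho * theta * (p h * p k).
Proof.
have := le_L (h *m PR) (k *m PR).
by rewrite !a_PR !b_PR mul0r sub0r normrN !relRE rhoE => /le_trans; apply; lra.
Qed.

Lemma F_expand h k : F h k = (a h * a k) *: F phi phi
  + F phi (a h *: (k *m PR) + a k *: (h *m PR)) + F (h *m PR) (k *m PR).
Proof.
rewrite {1}(range_split h) {1}(range_split k).
rewrite !(bilinDl F_bilin, bilinDr F_bilin, bilinZl F_bilin, bilinZr F_bilin).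
rewrite (F_sym (h *m PR) phi); apply/rowP => i; rewrite !mxE; ring.
Qed.

(** [le_nu0] recovers the range component of [e'] from [e' *m A]. The coefficient [c] of [F phi phi]
    and the purely range term [w] are both second order, which gives [rho * r] and [theta * r] after
    division by [theta]; the mixed term gives [s]. *)
Lemma relR_expand c v w r s e' :
  e' *m A = c *: F phi phi + F phi v + w ->
  `|c| <= rho * theta * r -> nrm v <= theta * s -> nrm w <= B * theta ^+ 2 * r ->
  p e' <= nu0 * B * ((theta + rho) * r + s).
Proof.
move=> eA hc hv hw.
have h1 : theta * p e' <= nu0 * nrm (e' *m A).
  rewrite -relRE (le_trans (le_nu0 (a_PR _)))// mulmx_PR mulmxBl -scalemxAl.
  by rewrite phi_A scaler0 subr0.
have h2 : nrm (e' *m A) <= `|c| * B + B * nrm v + nrm w.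
  rewrite eA (le_trans (nrmD nrmP _ _))// lerD2r (le_trans (nrmD nrmP _ _))// lerD//.
    by rewrite nrmZ// ler_wpM2l// (le_trans (le_B _ _))// phi1 !mulr1.
  by rewrite (le_trans (le_B _ _))// phi1 mul1r.
have h3 := ler_wpM2r (ltW B_gt0) hc; have h4 := ler_wpM2l (ltW B_gt0) hv.
have h5 : nrm (e' *m A) <= theta * (B * ((theta + rho) * r + s)) by lra.
have h6 := ler_wpM2l (ltW nu0_gt0) h5.
by rewrite -(ler_pM2l theta_gt0); lra.
Qed.

Definition newton_step zeta e e' := e' *m A + F zeta e' = F zeta e - 2^-1 *: F e e.

Lemma le_bb2 h k k' :
  `|b h * (b k - b k') - b k ^+ 2 / 2| <=
  rho * theta * (p h * (p k + p k') + p k ^+ 2 / 2).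
Proof.
have -> : b h * (b k - b k') - b k ^+ 2 / 2 = b h * b (k - k') - (b k * b k) / 2.
  by rewrite linearB.
rewrite (le_trans (ler_normB _ _))// [`|_ / 2|]normrM [`|2^-1|]ger0_norm ?invr_ge0//.
have := le_bb h (k - k'); have h1 := le_bb k k.
have rt : 0 <= rho * theta by case: params => t0 tr _ _; rewrite mulr_ge0//; lra.
have := ler_wpM2l rt (ler_wpM2l (relR_ge0 h) (relRB k k')).
by lra.
Qed.

(** [a] annihilates the range of [A], so only the quadratic terms remain, and [K] cancels. *)
Lemma newton_step_a zeta e e' : newton_step zeta e e' ->
  a zeta * (a e - a e') - a e ^+ 2 / 2 = b zeta * (b e - b e') - b e ^+ 2 / 2.
Proof.
move=> /(congr1 a); rewrite linearD linearB linearZ/= a_A !a_F => h.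
by apply: (mulfI K_neq0); lra.
Qed.

Lemma newton_step_a_le zeta e e' : newton_step zeta e e' ->
  `|a zeta * (a e - a e') - a e ^+ 2 / 2|
    <= rho * theta * (p zeta * (p e + p e') + p e ^+ 2 / 2).
Proof.
by move=> /newton_step_a ->; exact: le_bb2.
Qed.

(** After expansion the coefficient of [F phi phi] is exactly the residual of the scalar recursion.
    By [newton_step_a_le] it is quadratic in range components, so it costs no more than the purely
    range terms. *)
Lemma newton_step_relR zeta e e' : newton_step zeta e e' ->
  p e' <= nu0 * B * ((theta + rho) * (p zeta * (p e + p e') + p e ^+ 2 / 2)
    + (`|a zeta - a e| * p e + `|a zeta| * p e' + `|a e - a e'| * p zeta)).
Proof.
move=> st.
apply: (@relR_expand (a zeta * (a e - a e') - a e ^+ 2 / 2)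
  ((a zeta - a e) *: (e *m PR) - a zeta *: (e' *m PR)
    + (a e - a e') *: (zeta *m PR))
  (F (zeta *m PR) ((e - e') *m PR) - 2^-1 *: F (e *m PR) (e *m PR))).
- have -> : e' *m A = F zeta (e - e') - 2^-1 *: F e e.
    by rewrite (bilinBr F_bilin) addrAC -st addrK.
  rewrite [F zeta _]F_expand [F e e]F_expand formB.
  rewrite !(mulmxBl, bilinDr F_bilin, bilinNr F_bilin, bilinZr F_bilin).
  rewrite !(scalerDr, scalerA, scalerBl, scalerBr).
  set X1 := F phi phi.
  set X2 := F phi (e *m PR). set X3 := F phi (e' *m PR).
  set X4 := F phi (zeta *m PR). set X5 := F (zeta *m PR) _. set X6 := F (zeta *m PR) _.
  set X7 := F (e *m PR) _.
  move: (a zeta) (a e) (a e') X1 X2 X3 X4 X5 X6 X7 => x y z X1 X2 X3 X4 X5 X6 X7.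
  by apply/rowP => i; rewrite !mxE; field.
- exact: newton_step_a_le.
- rewrite (le_trans (nrmD nrmP _ _))// (le_trans (lerD (nrmB nrmP _ _) (lexx _)))//.
  by rewrite !nrmZ// !relRE; lra.
rewrite (le_trans (nrmB nrmP _ _))// nrmZ// ger0_norm ?invr_ge0//.
have := le_B (zeta *m PR) ((e - e') *m PR); have h1 := le_B (e *m PR) (e *m PR).
rewrite !relRE in h1 *.
have h2 := ler_wpM2l (relR_ge0 zeta) (relRB e e').
have h3 := ler_wpM2l (ltW B_gt0) (ler_wpM2l (sqr_ge0 theta) h2).
by lra.
Qed.

(* Since z_k is the midpoint of x_k and y_k, the term f''(e, e) cancels. *)
Lemma newton_step_midpoint g e e' : newton_step (2^-1 *: (e + g)) e e' ->
  e' *m A = 2^-1 *: (F g (e - e') - F e e').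
Proof.
rewrite /newton_step !(bilinZl F_bilin) !(bilinDl F_bilin) (bilinBr F_bilin) => st.
apply: (addIr (2^-1 *: (F e e' + F g e'))); rewrite st.
move: (F e e) (F e e') (F g e) (F g e') => X1 X2 X3 X4.
by apply/rowP => i; rewrite !mxE; field.
Qed.

Lemma midpoint_a g e e' : newton_step (2^-1 *: (e + g)) e e' ->
  a g * (a e - a e') - a e * a e' = b g * (b e - b e') - b e * b e'.
Proof.
move=> /newton_step_midpoint/(congr1 a); rewrite linearZ linearB/= a_A !a_F.
rewrite !linearB => h.
by apply: (mulfI K_neq0); lra.
Qed.

Lemma midpoint_a_le g e e' : newton_step (2^-1 *: (e + g)) e e' ->
  `|a g * (a e - a e') - a e * a e'|
    <= rho * theta * (p g * (p e + p e') + p e * p e').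
Proof.
move=> /midpoint_a ->.
have -> : b g * (b e - b e') - b e * b e' = b g * b (e - e') - b e * b e'.
  by rewrite linearB.
rewrite (le_trans (ler_normB _ _))//.
have := le_bb g (e - e'); have h1 := le_bb e e'.
have rt : 0 <= rho * theta by case: params => t0 tr _ _; rewrite mulr_ge0//; lra.
have := ler_wpM2l rt (ler_wpM2l (relR_ge0 g) (relRB e e')).
by lra.
Qed.

(** The decomposition is that of [newton_step_relR], applied to the midpoint identity, whose factor
    1/2 is kept in front. *)
Lemma midpoint_relR g e e' : newton_step (2^-1 *: (e + g)) e e' ->
  p e' <= nu0 * B / 2 * ((theta + rho) * (p g * (p e + p e') + p e * p e')
    + (`|a g - a e'| * p e + `|a e + a g| * p e' + `|a e - a e'| * p g)).
Proof.
move=> st; rewrite -mulrA [2^-1 * _]mulrC.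
have -> : forall x y, ((theta + rho) * x + y) / 2 = (theta + rho) * (x / 2) + y / 2.
  by move=> x y; ring.
apply: (@relR_expand (2^-1 * (a g * (a e - a e') - a e * a e'))
  (2^-1 *: ((a g - a e') *: (e *m PR) - (a e + a g) *: (e' *m PR)
    + (a e - a e') *: (g *m PR)))
  (2^-1 *: (F (g *m PR) ((e - e') *m PR) - F (e *m PR) (e' *m PR)))).
- rewrite (newton_step_midpoint st).
  rewrite [F g _]F_expand [F e e']F_expand formB.
  rewrite !(mulmxBl, bilinDr F_bilin, bilinNr F_bilin, bilinZr F_bilin).
  rewrite !(scalerDr, scalerA, scalerBl, scalerBr).
  set X1 := F phi phi.
  set X2 := F phi (e *m PR). set X3 := F phi (e' *m PR).
  set X4 := F phi (g *m PR). set X5 := F (g *m PR) _. set X6 := F (g *m PR) _.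
  set X7 := F (e *m PR) _.
  move: (a g) (a e) (a e') X1 X2 X3 X4 X5 X6 X7 => x y z X1 X2 X3 X4 X5 X6 X7.
  by apply/rowP => i; rewrite !mxE; field.
- rewrite normrM ger0_norm ?invr_ge0//.
  by have := midpoint_a_le st; lra.
- rewrite nrmZ// ger0_norm ?invr_ge0//.
  have half (x y : R) : x <= theta * y -> 2^-1 * x <= theta * (y / 2) by lra.
  apply: half.
  rewrite (le_trans (nrmD nrmP _ _))// (le_trans (lerD (nrmB nrmP _ _) (lexx _)))//.
  by rewrite !nrmZ// !relRE; lra.
rewrite nrmZ// ger0_norm ?invr_ge0//.
have h0 := nrmB nrmP (F (g *m PR) ((e - e') *m PR)) (F (e *m PR) (e' *m PR)).
have := le_B (g *m PR) ((e - e') *m PR); have h1 := le_B (e *m PR) (e' *m PR).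
rewrite !relRE in h1 *.
have h2 := ler_wpM2l (relR_ge0 g) (relRB e e').
have h3 := ler_wpM2l (ltW B_gt0) (ler_wpM2l (sqr_ge0 theta) h2).
by lra.
Qed.

(** With the Jacobian taken at the current point, the right-hand side factors as [F e d] with
    [d = e / 2 - g]. Its phi-component is zero, so [a d = b e * b d]: the whole norm of [d] is
    controlled by its range component, and the size of [e] supplies the factor [N]. *)
Lemma first_newton_step_relR e g : newton_step e e g -> a e = 1 ->
  p e <= 1 -> nu0 * B * nrm e * (1 + rho) <= N -> p g <= N * (1 / 2 + p g).
Proof.
move=> st ae pe hN.
have gA : g *m A = F e (2^-1 *: e - g).
  rewrite (bilinBr F_bilin) (bilinZr F_bilin); apply: (addIr (F e g)); rewrite st subrK.
  by apply/rowP => i; rewrite !mxE; field.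
set d := 2^-1 *: e - g in gA.
have pd : p d <= 1 / 2 + p g.
  rewrite (le_trans (relRB _ _))// lerD2r relRZ ger0_norm ?invr_ge0//.
  by lra.
have pd0 := relR_ge0 d.
have [t0 tr r1 _] := params.
have ad : `|a d| <= rho * theta * p d.
  have : a e * a d = b e * b d.
    have := congr1 a gA; rewrite a_A a_F => /esym/eqP.
    by rewrite mulf_eq0 (negPf K_neq0)/= subr_eq0 => /eqP.
  rewrite ae mul1r => ->; rewrite (le_trans (le_bb _ _))//.
  have rt : 0 <= rho * theta by rewrite mulr_ge0//; lra.
  by rewrite ler_wpM2l// ler_piMl.
have nd : nrm d <= theta * (1 + rho) * p d.
  by have := norm_le_split d; lra.
have h1 : theta * p g <= nu0 * nrm (g *m A).
  rewrite -relRE (le_trans (le_nu0 (a_PR _)))// mulmx_PR mulmxBl -scalemxAl.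
  by rewrite phi_A scaler0 subr0.
have h2 : theta * p g <= nu0 * B * nrm e * nrm d.
  by rewrite (le_trans h1)// gA -!mulrA ler_wpM2l ?(ltW nu0_gt0)// le_B.
have h3 : 0 <= nu0 * B * nrm e by rewrite !mulr_ge0 ?(nrm_ge0 nrmP) ?ltW.
have h4 := ler_wpM2l h3 nd.
have h5 : theta * p g <= theta * (nu0 * B * nrm e * (1 + rho) * p d) by lra.
rewrite ler_pM2l// in h5; rewrite (le_trans h5)//.
apply: ler_pM => //; rewrite mulr_ge0//; lra.
Qed.


Lemma params_kappa_sum : [/\ [/\ 0 < N, N <= 1 / 8, N * (rho * theta) <= 1 / 18,
    N * (theta + rho) <= 1 / 6 & N <= (1 - rho * theta) / 4] /\
  [/\ N * (1 + (theta + rho) + rho * theta) <= 1 / 3, N <= theta / 2,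
      N * theta <= 2 / 27 & N <= rho * (1 - rho) / 2],
  [/\ 0 <= rho * theta, rho * theta <= 1, rho * theta <= theta & theta < 1],
  0 <= theta + rho & theta + rho <= 2].
Proof.
have [t0 tr r1 _] := params.
have r0 : 0 < rho by lra.
have h1 := cone_params_prod params; have h2 := cone_params_le_theta params.
have h3 : 0 <= theta ^+ 2 by rewrite sqr_ge0.
have h4 : 0 <= rho * theta by rewrite mulr_ge0 ?ltW.
have h5 : rho * theta <= theta by rewrite ler_piMl// ltW.
split; [split; split|split| |] => //; try lra.
- exact: cone_params_gt0 params.
- exact: cone_params_le8 params.
- exact: cone_params_kappa params.
- exact: cone_params_sum params.
- exact: cone_params_compl params.
- exact: cone_params_theta params.
- exact: cone_params_le_rho params.
Qed.

(** * The error sequences of the iteration and their invariant *)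

Variables (e g z : nat -> 'rV[R]_m).
Local Notation zp := (zprev e z).
Hypothesis zE : forall k : nat, z k = 2^-1 *: (e k + g k).
Hypothesis gE : forall k : nat, newton_step (zp k) (e k) (g k).
Hypothesis eE : forall k : nat, newton_step (z k) (e k) (e k.+1).
Hypotheses (a_e0 : a (e 0%N) = 1) (p_e0 : p (e 0%N) <= 1).
Hypothesis small_e0 : nu0 * B * nrm (e 0%N) * (1 + rho) <= N.

(** [le_L] at [phi] and [e 0] bounds [theta] by [rho * nrm (e 0)]; with the cone condition this
    yields [1 <= (1 + rho) * nrm (e 0)]. The smallness assumption then becomes [nu0 * B <= N], free
    of [e 0]. *)
Lemma e0_bounds : [/\ theta <= rho * nrm (e 0%N), 1 <= (1 + rho) * nrm (e 0%N),
  1 / 2 <= nrm (e 0%N), 0 <= nu0 * B & nu0 * B <= N].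
Proof.
have [t0 tr r1 _] := params.
have h1 : theta <= rho * nrm (e 0%N).
  have := le_L phi (e 0%N); rewrite a_phi b_phi a_e0 phi1 !mul1r mul0r subr0 normr1.
  by move=> /(ler_wpM2r (ltW t0)); rewrite rhoE; lra.
have h2 : 1 <= nrm (e 0%N) + theta.
  have := split_le_norm (e 0%N); rewrite a_e0 normr1 => /le_trans; apply.
  by rewrite lerD2l ler_piMr// ltW.
have h3 := nrm_ge0 nrmP (e 0%N).
have h4 : (1 + rho) * nrm (e 0%N) <= 2 * nrm (e 0%N) by rewrite ler_wpM2r//; lra.
have h5 : 0 <= nu0 * B by rewrite mulr_ge0 ?ltW.
have h6 : 1 <= (1 + rho) * nrm (e 0%N) by lra.
split => //; first lra.
have := ler_wpM2l h5 h6; have := small_e0; lra.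
Qed.

Lemma a_z (k : nat) : a (z k) = (a (e k) + a (g k)) / 2.
Proof. by rewrite zE linearZ/= linearD mulrC. Qed.

Lemma p_z (k : nat) : p (z k) <= (p (e k) + p (g k)) / 2.
Proof.
by rewrite zE relRZ ger0_norm ?invr_ge0// mulrC ler_pM2r ?invr_gt0// relRD.
Qed.

Lemma first_y : [/\ p (g 0%N) <= 4 / 7 * N,
  a (g 0%N) = (1 - b (e 0%N) ^+ 2) / 2 + b (e 0%N) * b (g 0%N)
  & 0 <= b (e 0%N) ^+ 2 <= rho * theta].
Proof.
have [[[N0 N8 _ _ _] _] [k0 _ _ _] _ _] := params_kappa_sum.
split.
- apply: first_y_bound => //; first exact: relR_ge0.
  exact: first_newton_step_relR (gE 0%N) _ _ _.
- by have := newton_step_a (gE 0%N); rewrite /= a_e0; lra.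
rewrite sqr_ge0/= -[_ ^+ 2]ger0_norm ?sqr_ge0// expr2 (le_trans (le_bb _ _))//.
by rewrite ler_piMr// mulr_ile1// relR_ge0.
Qed.

Lemma first_x : [/\ 0 < a (g 0%N), p (g 0%N) <= a (g 0%N), 0 < a (e 1%N)
    & a (e 1%N) <= 2 / 5] /\
  [/\ a (e 1%N) <= 3 / 5 * ((1 + a (g 0%N)) / 2), p (e 1%N) <= 3 * N * a (e 1%N)
    & a (g 0%N) <= 3 / 5].
Proof.
have [[[N0 N8 Nk Ns Nc] _] [k0 k1 _ _] s0 s2] := params_kappa_sum.
have [_ _ _ nu0' nuN] := e0_bounds.
have [gN ag /andP[b0 bk]] := first_y.
have u0 := relR_ge0 (e 1%N); have g0 := relR_ge0 (g 0%N).
have st := eE 0%N; rewrite zE in st.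
apply: (@first_x_bound _ N (rho * theta) (theta + rho) (nu0 * B)
  (1 - b (e 0%N) ^+ 2) (p (g 0%N)) (p (e 1%N))) => //; try lra.
- rewrite ag addrAC subrr add0r (le_trans (le_bb _ _))//.
  by rewrite ler_wpM2l// ler_piMl.
- have := midpoint_a st; rewrite a_e0 => h.
  have -> : a (e 1%N) * (1 + a (g 0%N)) - (1 - b (e 0%N) ^+ 2) / 2
      = b (e 0%N) * b (e 1%N) + b (g 0%N) * b (e 1%N) by move: h ag; lra.
  rewrite (le_trans (ler_normD _ _))// (le_trans (lerD (le_bb _ _) (le_bb _ _)))//.
  rewrite -mulrDr ler_wpM2l// -mulrDl ler_wpM2r// lerD2r//.
- have := midpoint_relR st; rewrite a_e0 => /le_trans; apply.
  rewrite ler_wpM2l ?divr_ge0//.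
  have h1 : (theta + rho) * (p (g 0%N) * (p (e 0%N) + p (e 1%N)) + p (e 0%N) * p (e 1%N))
    <= (theta + rho) * (p (g 0%N) * (1 + p (e 1%N)) + p (e 1%N)).
    by rewrite ler_wpM2l// lerD// ?ler_wpM2l ?lerD2r// ler_piMl.
  have h2 : `|a (g 0%N) - a (e 1%N)| * p (e 0%N) <= `|a (g 0%N) - a (e 1%N)|.
    by rewrite ler_piMr.
  (* The sign of [a (g 0)] is a conclusion of the bound being applied, so that of [1 + a (g 0)] is
     derived here from [first_y] and [le_bb]. *)
  have h3 : `|1 + a (g 0%N)| = 1 + a (g 0%N).
    rewrite ger0_norm//.
    have := le_bb (e 0%N) (g 0%N); rewrite ler_norml => /andP[h3 _].
    have h4 : rho * theta * (p (e 0%N) * p (g 0%N)) <= 1 * (1 * p (g 0%N)).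
      apply: ler_pM => //; first by rewrite mulr_ge0 ?relR_ge0.
      by apply: ler_pM => //; exact: relR_ge0.
    by move: ag h3 h4 b0 bk k1 gN N8; lra.
  by rewrite h3; lra.
Qed.

(** This starts at [k = 1], since [a (e 0) = 1]. The comparison of [a (e k)] with [a (zp k)] keeps
    the lagged Jacobian of the y-step far enough from the singular point relative to the current
    error. *)
Definition newton_invariant (k : nat) :=
  [/\ 0 < a (e k), a (e k) <= 2 / 5, a (e k) <= 3 / 5 * a (zp k)
    & a (zp k) <= 4 / 5] /\
  (p (zp k) <= a (zp k) /\ p (e k) <= 3 * N * a (e k)).

Lemma later_y (k : nat) : newton_invariant k ->
  [/\ p (g k) <= 8 / 5 * N * a (e k), 21 / 50 * a (e k) <= a (g k),
      a (g k) <= (1 + 5 * (N * (rho * theta))) * a (e k) & a (g k) <= 103 / 250].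
Proof.
move=> [[a0 a1 az az1] [pz pe]].
have [[[N0 N8 Nk _ _] [N3 _ _ _]] [k0 _ _ _] s0 _] := params_kappa_sum.
have [_ _ _ nu0' nuN] := e0_bounds.
have h := newton_step_relR (gE k).
rewrite [`|a (zp k)|]ger0_norm in h; last lra.
apply: (@later_y_bound _ N (rho * theta) (theta + rho) (nu0 * B)
  (a (e k)) (a (zp k)) (p (e k)) (p (zp k)) (p (g k))) => //.
all: first [exact: relR_ge0|exact: newton_step_a_le (gE k)|by move: h; rewrite !addrA].
Qed.

Lemma later_x (k : nat) : newton_invariant k -> newton_invariant k.+1 /\
  a (e k.+1) + theta * p (e k.+1) <= (1 + theta) / 2 * a (e k).
Proof.
move=> inv; have [gN ag1 ag2 ag3] := later_y inv.
move: inv => [[a0 a1 az az1] [pz pe]].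
have [[[N0 N8 Nk Ns _] [_ Nt _ _]] [k0 k1 kt t1] s0 _] := params_kappa_sum.
have [_ _ _ nu0' nuN] := e0_bounds.
have st := eE k; rewrite zE in st.
have h := midpoint_relR st.
have [h0 h0'] : 0 <= a (g k) /\ 0 <= a (e k) + a (g k) by split; lra.
rewrite [`|a (e k) + a (g k)|]ger0_norm// in h.
have {}h : p (e k.+1) <= nu0 * B / 2 * ((theta + rho)
      * (p (g k) * (p (e k) + p (e k.+1)) + p (e k) * p (e k.+1))
    + `|a (g k) - a (e k.+1)| * p (e k) + (a (e k) + a (g k)) * p (e k.+1)
    + `|a (e k) - a (e k.+1)| * p (g k)).
  by move: h; rewrite !addrA.
have ha := midpoint_a_le st; rewrite -normrN in ha.
have [[e1 e2 e3] [e4 e5]] : [/\ 0 < a (e k.+1), a (e k.+1) <= 2 / 5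
    & a (e k.+1) <= 3 / 5 * ((a (e k) + a (g k)) / 2)] /\
    p (e k.+1) <= 3 * N * a (e k.+1) /\
    a (e k.+1) + theta * p (e k.+1) <= (1 + theta) / 2 * a (e k).
  apply: (@later_x_bound _ N (rho * theta) (theta + rho) (nu0 * B) theta
    (a (e k)) (p (e k)) (p (g k)) (a (g k))) => //.
  all: try by [exact: relR_ge0|exact: ltW t1].
  apply: le_trans ha; rewrite le_eqVlt; apply/orP; left; apply/eqP.
  by congr (`|_|); ring.
split => //; split; [split|split] => //=.
- by rewrite a_z.
- rewrite a_z; lra.
- rewrite a_z (le_trans (p_z _))// ler_pM2r ?invr_gt0//.
  have h1 : N * a (e k) <= 1 / 8 * a (e k) by rewrite ler_wpM2r// ltW.
  by lra.
Qed.

Lemma newton_invariantS (k : nat) : newton_invariant k.+1.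
Proof.
elim: k => [|k IH]; last exact: (later_x IH).1.
have [[ag0 pg ae0 ae1] [ae2 pe ag1]] := first_x.
split; [split|split] => //=.
- by rewrite a_z a_e0.
- by rewrite a_z a_e0; lra.
- by rewrite a_z a_e0 (le_trans (p_z _))// ler_pM2r ?invr_gt0// lerD.
Qed.

Lemma newton_cone (k : nat) : [/\ 0 <= p (e k) <= a (e k), 0 <= p (g k) <= a (g k) &
  0 <= p (z k) <= a (z k)].
Proof.
have [[[N0 N8 _ _ _] _] _ _ _] := params_kappa_sum.
suff [h1 h2] : p (e k) <= a (e k) /\ p (g k) <= a (g k).
  rewrite !relR_ge0 h1 h2 /= a_z (le_trans (p_z _))//.
  by rewrite ler_pM2r ?invr_gt0// lerD.
case: k => [|k]; first by have [[_ pg _ _] _] := first_x; rewrite a_e0.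
have inv := newton_invariantS k; have [gN ag1 _ _] := later_y inv.
move: inv => [[a0 _ _ _] [_ pe]].
have h1 : N * a (e k.+1) <= 1 / 8 * a (e k.+1) by rewrite ler_wpM2r// ltW.
by split; lra.
Qed.

(** By Young's inequality the terms in [b (e 0)] leave 1/2, hence at most
    [(1 + rho) / 2 * nrm (e 0)] by [e0_bounds]. The other terms carry a factor [1 - rho] through [N]
    and fit into the remaining [(1 - rho) / 2 * nrm (e 0)]. *)
Lemma first_y_norm : nrm (g 0%N) <= nrm (e 0%N).
Proof.
have [[[N0 N8 _ _ _] [_ _ _ Nr]] [k0 k1 kt t1] _ _] := params_kappa_sum.
have [te e1 _ _ _] := e0_bounds.
have [t0 tr r1 _] := params.
have [gN ag _] := first_y.
have [[ag0 _ _ _] _] := first_x.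
rewrite (le_trans (norm_le_split _))// gtr0_norm//.
have g0 := relR_ge0 (g 0%N).
have h1 : b (e 0%N) * b (g 0%N) <= b (e 0%N) ^+ 2 / 2 + b (g 0%N) * b (g 0%N) / 2.
  by have := sqr_ge0 (b (e 0%N) - b (g 0%N)); lra.
have h2 := le_trans (ler_norm _) (le_bb (g 0%N) (g 0%N)).
have h3 : rho * theta * (p (g 0%N) * p (g 0%N)) <= theta * (1 / 14 * p (g 0%N)).
  apply: ler_pM => //; first exact: mulr_ge0.
  by apply: ler_wpM2r => //; lra.
have n0 := nrm_ge0 nrmP (e 0%N).
have h4 : theta * p (g 0%N) <= rho * nrm (e 0%N) * (2 / 7 * (1 - rho)).
  apply: ler_pM => //; first exact: ltW.
  have : rho * (1 - rho) <= 1 * (1 - rho) by rewrite ler_wpM2r//; lra.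
  by lra.
have h5 : rho * (nrm (e 0%N) * (1 - rho)) <= 1 * (nrm (e 0%N) * (1 - rho)).
  by rewrite ler_wpM2r// ?mulr_ge0//; lra.
have h6 : 0 <= nrm (e 0%N) * (1 - rho) by rewrite mulr_ge0//; lra.
by rewrite ag; lra.
Qed.

(** From index 1 on the errors of x and y have norm at most 1/2, which is below [nrm (e 0)]; those
    of z follow by the triangle inequality. *)
Lemma newton_norm (k : nat) : [/\ nrm (e k) <= nrm (e 0%N), nrm (g k) <= nrm (e 0%N)
  & nrm (z k) <= nrm (e 0%N)].
Proof.
suff [h1 h2] : nrm (e k) <= nrm (e 0%N) /\ nrm (g k) <= nrm (e 0%N).
  split => //; rewrite zE nrmZ// ger0_norm ?invr_ge0//.
  by have := nrmD nrmP (e k) (g k); lra.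
case: k => [|k]; first by split => //; exact: first_y_norm.
have [_ _ e12 _ _] := e0_bounds.
have [[[N0 _ _ _ _] [_ _ Nt _]] _ _ _] := params_kappa_sum.
have inv := newton_invariantS k; have [gN ag1 _ ag2] := later_y inv.
move: inv => [[a0 a1 _ _] [_ pe]].
have h1 : N * theta * a (e k.+1) <= 2 / 27 * (2 / 5).
  by apply: ler_pM => //; rewrite ?mulr_ge0 ?ltW.
split; apply: le_trans e12; rewrite (le_trans (norm_le_split _))// ger0_norm; try lra.
- by have := ler_wpM2l (ltW theta_gt0) pe; lra.
- by have := ler_wpM2l (ltW theta_gt0) gN; lra.
Qed.

(** Both norms are compared with [a (e k)]: the cone gives [(1 - theta) * a (e k) <= nrm (e k)], and
    one step gives [nrm (e k.+1) <= (1 + theta) / 2 * a (e k)]. *)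
Lemma newton_contraction (k : nat) :
  (1 - theta) * nrm (e k.+1) <= (1 + theta) / 2 * nrm (e k).
Proof.
have [t0 _ _ _] := params.
have [[[N0 _ _ _ _] [_ _ Nt _]] [_ _ _ t1] _ _] := params_kappa_sum.
have ak : (1 - theta) * a (e k) <= nrm (e k).
  have [/andP[p0 pa] _ _] := newton_cone k.
  have := split_le_norm (e k); rewrite ger0_norm ?(le_trans p0 pa)//.
  have := ler_wpM2l (ltW t0) pa; lra.
have ak1 : nrm (e k.+1) <= a (e k.+1) + theta * p (e k.+1).
  have [/andP[p0 pa] _ _] := newton_cone k.+1.
  by rewrite (le_trans (norm_le_split _))// ger0_norm// (le_trans p0 pa).
have ae : nrm (e k.+1) <= (1 + theta) / 2 * a (e k).
  rewrite (le_trans ak1)//; case: k {ak ak1} => [|k].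
    rewrite a_e0; have [[_ _ a0 a1] [_ pe _]] := first_x.
    have h1 : N * theta * a (e 1%N) <= 2 / 27 * (2 / 5).
      by apply: ler_pM => //; rewrite ?mulr_ge0 ?ltW.
    have := ler_wpM2l (ltW t0) pe; lra.
  exact: (later_x (newton_invariantS k)).2.
have h1 : 0 <= 1 - theta by lra.
have h2 : 0 <= (1 + theta) / 2 by lra.
have := ler_wpM2l h1 ae; have := ler_wpM2l h2 ak; lra.
Qed.

End SingularNewton.

(** * Limits along the kernel, and quadratic maps *)

Lemma injective_unitmx (K : fieldType) (m : nat) (M : 'M[K]_m) :
  (forall v : 'rV[K]_m, v *m M = 0 -> v = 0) -> M \in unitmx.
Proof.
move=> inj; rewrite -row_free_unit -kermx_eq0; apply/rowV0P => v.
by move=> /sub_kermxP; exact: inj.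
Qed.

Lemma le_of_small (R : realFieldType) (x y c t0 : R) : 0 < t0 ->
  (forall t, 0 < t -> t < t0 -> x <= y + t * c) -> x <= y.
Proof.
move=> t00 h; apply/ler_addgt0Pr => e e0.
have c1 : 0 < `|c| + 1 by rewrite ltr_wpDl.
set t := Num.min (t0 / 2) (e / (`|c| + 1)).
have tgt : 0 < t by rewrite lt_min !divr_gt0.
have tlt : t < t0.
  rewrite (@le_lt_trans _ _ (t0 / 2)) ?ge_min ?lexx//.
  by rewrite ltr_pdivrMr// ltr_pMr// ltr1n.
rewrite (le_trans (h t tgt tlt))// lerD2l.
have ht : t * (`|c| + 1) <= e by rewrite -ler_pdivlMr// ge_min lexx orbT.
rewrite (le_trans _ ht)// ler_wpM2l ?(ltW tgt)//.
by rewrite (le_trans (ler_norm c))// lerDl.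
Qed.

Section LimitBounds.
Variables (R : realType) (m : nat) (nrm : 'rV[R]_m -> R).
Hypothesis nrmP : is_norm nrm.
Variables (A PN PR : 'M[R]_m) (F : 'rV[R]_m -> 'rV[R]_m -> 'rV[R]_m).
Variables (phi : 'rV[R]_m) (a b : {scalar 'rV[R]_m}).
Variables (mu0 nu0 K t0 : R) (J : R -> 'M[R]_m).
Implicit Types (h k v w : 'rV[R]_m) (t : R).
Hypotheses (PN_E : forall h, h *m PN = a h *: phi) (PNR : PN + PR = 1%:M).
Hypotheses (phi1 : nrm phi = 1) (a_phi : a phi = 1) (b_phi : b phi = 0).
Hypothesis a_A : forall h, a (h *m A) = 0.
Hypothesis phi_A : phi *m A = 0.
Hypothesis A_ker : forall v, v *m A = 0 -> v = a v *: phi.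
Hypothesis A_range : forall v, a v = 0 -> exists w, v = w *m A.
Hypothesis F_bilin : bilinear_map F.
Hypothesis K_neq0 : K != 0.
Hypothesis a_F : forall h k, a (F h k) = K * (a h * a k - b h * b k).
Hypotheses (mu0_gt0 : 0 < mu0) (nu0_gt0 : 0 < nu0) (t0_gt0 : 0 < t0).
Hypothesis J_E : forall t v, v *m J t = v *m A - t *: F phi v.
Hypothesis J_bound : forall t, 0 < t -> t < t0 ->
  opnorm nrm (invmx (J t) *m PN) <= mu0 * t^-1 /\
  opnorm nrm (invmx (J t) *m PR) <= nu0.

Lemma PR_id v : a v = 0 -> v *m PR = v.
Proof.
move=> av; rewrite -[RHS]mulmx1 -PNR mulmxDr PN_E av scale0r add0r//.
Qed.

(** [A + PN] is invertible and agrees with [A] where [a] vanishes. *)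
Lemma ker_bound : exists2 C : R, 0 <= C &
  forall v, a v = 0 -> nrm v <= C * nrm (v *m A).
Proof.
have u : A + PN \in unitmx.
  apply: injective_unitmx => v; rewrite mulmxDr PN_E => hv.
  have av : a v = 0.
    by have := congr1 a hv; rewrite linearD a_A linearZ/= a_phi mulr1 add0r linear0.
  by move: hv; rewrite av scale0r addr0 => /A_ker ->; rewrite av scale0r.
have [C C0 hC] := nrm_mulmx_bounded nrmP (invmx (A + PN)).
exists C => // v av; rewrite (le_trans _ (hC _))//.
have -> : v *m A = v *m (A + PN) by rewrite mulmxDr PN_E av scale0r addr0.
by rewrite mulmxK.
Qed.

(** [J_bound] concerns true inverses only where [J t] is nonsingular. If [v *m A = t *: F phi v],
    applying [a] gives [a v = 0], and then [ker_bound] bounds [nrm v] by a fraction of itself for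
    small [t]. *)
Lemma J_unit : exists2 t1 : R, 0 < t1 & forall t, 0 < t -> t < t1 -> J t \in unitmx.
Proof.
have [C C0 hC] := ker_bound; have [B B0 hB] := nrm_bilin_bounded nrmP F_bilin.
have CB : 0 < C * B + 1 by rewrite ltr_wpDl// mulr_ge0.
exists (C * B + 1)^-1; first by rewrite invr_gt0.
move=> t t0' t1; apply: injective_unitmx => v; rewrite J_E => /eqP.
rewrite subr_eq0 => /eqP hv.
have av : a v = 0.
  have := congr1 a hv; rewrite a_A linearZ/= a_F a_phi b_phi mul0r subr0 mul1r.
  by move=> /esym/eqP; rewrite !mulf_eq0 (negPf K_neq0) gt_eqF//= => /eqP.
apply: norm_definite nrmP _ _; apply/eqP; rewrite eq_le nrm_ge0// andbT.
have h1 := hC _ av; rewrite hv nrmZ// gtr0_norm// in h1.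
have h2 := hB phi v; rewrite phi1 mul1r in h2.
have h3 : nrm v <= t * (C * B) * nrm v.
  rewrite (le_trans h1)// mulrCA -mulrA ler_wpM2l ?(ltW t0')//.
  by rewrite -mulrA ler_wpM2l.
have h4 : t * (C * B + 1) < 1 by rewrite -ltr_pdivlMr// mul1r.
have : (1 - t * (C * B)) * nrm v <= 0 by rewrite mulrBl mul1r subr_le0.
by rewrite pmulr_rle0// subr_gt0 (lt_trans _ h4)// ltr_pM2l// ltrDl.
Qed.

(** Write [v] as [v *m J t *m invmx (J t) *m PR] and let [t] tend to 0. *)
Lemma range_bound v : a v = 0 -> nrm v <= nu0 * nrm (v *m A).
Proof.
move=> av; have [t1 t10 hu] := J_unit.
apply: (@le_of_small _ _ _ (nu0 * nrm (F phi v)) (Num.min t0 t1)).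
  by rewrite lt_min t0_gt0.
move=> t tgt; rewrite lt_min => /andP[tt0 tt1].
have [_ hb] := J_bound tgt tt0; have u := hu _ tgt tt1.
have := opnorm_le nrmP (invmx (J t) *m PR) (v *m J t).
rewrite mulmxA mulmxK// PR_id// => /le_trans; apply.
rewrite (le_trans (ler_wpM2r (nrm_ge0 nrmP _) hb))//.
rewrite [t * _]mulrCA -mulrDr ler_wpM2l ?(ltW nu0_gt0)// J_E (le_trans (nrmB nrmP _ _))//.
by rewrite nrmZ// gtr0_norm.
Qed.

(** [J t] sends [(al / t) *: phi + kR] to [w - t *: F phi kR], and the kernel component of that
    preimage is [al / t]. Both sides of the [mu0] bound then scale like [1 / t], so a bound on [al]
    survives in the limit. *)
Lemma form_bound w : `|a w| <= mu0 * `|K| * nrm w.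
Proof.
have [t1 t10 hu] := J_unit.
(* This choice puts [w + al *: F phi phi] into the range of [A], because [a (F phi phi) = K]. *)
pose al := - (a w / K).
have [k0 hk0] : exists k, w + al *: F phi phi = k *m A.
  apply: A_range; rewrite linearD linearZ/= a_F a_phi b_phi mulr0 subr0 !mulr1.
  by rewrite mulNr divfK// subrr.
pose kR := k0 *m PR.
have akR : a kR = 0.
  have -> : kR = k0 - a k0 *: phi.
    by rewrite -PN_E -[X in X - _]mulmx1 -PNR mulmxDr addrC addKr.
  by rewrite linearB linearZ/= a_phi mulr1 subrr.
have kRA : kR *m A = w + al *: F phi phi.
  have -> : kR = k0 - a k0 *: phi.
    by rewrite -PN_E -[X in X - _]mulmx1 -PNR mulmxDr addrC addKr.
  by rewrite mulmxBl -scalemxAl phi_A scaler0 subr0.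
suff : `|al| <= mu0 * nrm w.
  rewrite normrN normrM normfV ler_pdivrMr ?normr_gt0// => h.
  by rewrite (le_trans h)// mulrAC.
apply: (@le_of_small _ _ _ (mu0 * nrm (F phi kR)) (Num.min t0 t1)).
  by rewrite lt_min t0_gt0.
move=> t tgt; rewrite lt_min => /andP[tt0 tt1].
have [hb _] := J_bound tgt tt0; have u := hu _ tgt tt1.
have vJ : ((al / t) *: phi + kR) *m J t = w - t *: F phi kR.
  rewrite J_E mulmxDl -scalemxAl phi_A scaler0 add0r kRA.
  rewrite (bilinDr F_bilin) (bilinZr F_bilin) scalerDr scalerA.
  by rewrite [t * _]mulrC divfK ?gt_eqF// opprD addrA addrK.
have := opnorm_le nrmP (invmx (J t) *m PN) (((al / t) *: phi + kR) *m J t).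
rewrite mulmxA mulmxK// PN_E linearD linearZ/= a_phi akR mulr1 addr0.
rewrite nrmZ// phi1 mulr1 vJ => h.
have {h} : `|al / t| <= mu0 / t * nrm (w - t *: F phi kR).
  by rewrite (le_trans h)// ler_wpM2r// nrm_ge0.
rewrite normrM normfV (gtr0_norm tgt) mulrAC ler_pM2r ?invr_gt0// => h.
rewrite (le_trans h)// [t * _]mulrCA -mulrDr ler_pM2l// (le_trans (nrmB nrmP _ _))//.
by rewrite nrmZ// gtr0_norm.
Qed.

End LimitBounds.

(** * Quadratic maps and their derivatives *)

Section Quadratic.
Variables (R : realType) (m : nat) (Q : 'rV[R]_m -> 'rV[R]_m -> 'rV[R]_m).
Variables (c0 : 'rV[R]_m).
Hypothesis QP : bilinear_map Q.
Implicit Types (x v h k : 'rV[R]_m).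

Definition polar h k := Q h k + Q k h.
Definition quadratic x := x + Q x x + c0.

Lemma polar_bilin : bilinear_map polar.
Proof.
split=> al h h' k; rewrite /polar (bilinDl QP) (bilinDr QP) (bilinZl QP) (bilinZr QP);
  by rewrite scalerDr addrACA.
Qed.

Lemma polarC h k : polar h k = polar k h.
Proof. by rewrite /polar addrC. Qed.

Lemma polar_diag h : polar h h = 2 *: Q h h.
Proof. by rewrite /polar scaler_nat mulr2n. Qed.

Lemma quadraticD x v : quadratic (x + v) = quadratic x + (v + polar x v) + Q v v.
Proof.
rewrite /quadratic /polar !(bilinDl QP) !(bilinDr QP).
by apply/rowP => i; rewrite !mxE; ring.
Qed.

Lemma derive_quadratic_line (f : 'rV[R]_m -> 'rV[R]_m) x v (D q : 'rV[R]_m) :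
  (forall t : R, f (t *: v + x) = f x + t *: D + t ^+ 2 *: q) -> 'D_v f x = D.
Proof.
move=> hf; apply: cvg_lim => //.
apply: (@cvg_trans _ ((fun t : R => D + t *: q) @ 0^')).
  apply: near_eq_cvg; near=> t.
  have tn0 : t != 0 by near: t; exact: nbhs_dnbhs_neq.
  by apply/rowP => i; rewrite /= hf !mxE; field.
have h : (fun t : R => D + t *: q) @ (0 : R) --> D + 0 *: q.
  apply: (@cvgD R 'rV[R]_m R (nbhs (0 : R)) _ (cst D) (fun t => t *: q)).
    exact: cvg_cst.
  exact: scalel_continuous.
rewrite scale0r addr0 in h.
exact: cvg_within_filter h.
Unshelve. all: by end_near. Qed.

Lemma quadratic_derive x v : 'D_v quadratic x = v + polar x v.
Proof.
apply: (@derive_quadratic_line _ _ _ _ (Q v v)) => t.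
rewrite addrC quadraticD (bilinZr polar_bilin) -scalerDr (bilinZl QP) (bilinZr QP).
by rewrite scalerA expr2.
Qed.

Lemma quadratic_derive2 x h k : second_derivative quadratic x h k = polar h k.
Proof.
apply: (@derive_quadratic_line _ _ _ _ 0) => t.
rewrite !quadratic_derive (bilinDl polar_bilin) (bilinZl polar_bilin).
by rewrite scaler0 addr0 -addrA [t *: _ + _]addrC (polarC h k).
Qed.

(** Directional derivatives determine ['J] only for a differentiable map; expansion in the standard
    basis reduces this to products of coordinates. *)
Lemma quadratic_differentiable x : differentiable quadratic x.
Proof.
have -> : quadratic = (id + \sum_(i < m) (fun y : 'rV[R]_m => \sum_(j < m)
   (y 0 i * y 0 j) *: Q (delta_mx 0 i) (delta_mx 0 j))) + cst c0.
  apply/funext => y; rewrite /quadratic [LHS]/=.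
  rewrite (bilin_coord QP) !fctE; congr (_ + _ + _).
  by rewrite fct_sumE.
apply: differentiableD; last exact: differentiable_cst.
apply: differentiableD; first by [].
apply: differentiable_sum => i.
have -> : (fun y : 'rV[R]_m => \sum_(j < m)
   (y 0 i * y 0 j) *: Q (delta_mx 0 i) (delta_mx 0 j)) = \sum_(j < m) (fun y : 'rV[R]_m =>
   (y 0 i * y 0 j) *: Q (delta_mx 0 i) (delta_mx 0 j)).
  by apply/funext => y; rewrite fct_sumE.
apply: differentiable_sum => j; apply: differentiableZl.
by apply: differentiableM; exact: differentiable_coord.
Qed.

Lemma quadratic_jacobian x v : v *m 'J quadratic x = v + polar x v.
Proof.
by rewrite -(deriveEjacobian v (quadratic_differentiable x)) quadratic_derive.
Qed.

End Quadratic.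

(** * The transport equation *)

Section Kernel.
Variables (R : realType) (n : nat) (omega wt : 'I_n -> R).
Hypotheses (omega_gt0 : forall i, 0 < omega i) (wt_gt0 : forall i, 0 < wt i).

Definition Pcoef i j := wt j * omega i / (2 * (omega i + omega j)).

Lemma Pmx_coef i j : Pmx 1 0 omega wt i j = Pcoef i j.
Proof.
rewrite mxE /q_ /delta_ /gamma_ /Pcoef addr0 subr0 mulr1 !mul1r.
have := omega_gt0 i; have := omega_gt0 j => hj hi; field.
by rewrite !lt0r_neq0 ?addr_gt0.
Qed.

Lemma Ptmx_coef i j : Ptmx 1 0 omega wt i j = Pcoef i j.
Proof. by rewrite -Pmx_coef !mxE /delta_ /gamma_ addr0 subr0. Qed.

Lemma Pcoef_gt0 i j : 0 < Pcoef i j.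
Proof. by rewrite /Pcoef divr_gt0 ?mulr_gt0 ?addr_gt0. Qed.

Lemma Pcoef_sym i j : wt i * Pcoef i j + wt j * Pcoef j i = wt i * wt j / 2.
Proof.
rewrite /Pcoef; have := omega_gt0 i; have := omega_gt0 j => hj hi; field.
by rewrite !lt0r_neq0 ?addr_gt0.
Qed.

Lemma Pcoef_omega i j : omega i * Pcoef i j + Pcoef i j * omega j = omega i * (wt j / 2).
Proof.
rewrite /Pcoef; have := omega_gt0 i; have := omega_gt0 j => hj hi; field.
by rewrite !lt0r_neq0 ?addr_gt0.
Qed.

Definition Pmul (y : 'I_n -> R) i := \sum_j Pcoef i j * y j.

Local Notation lc x i := (x 0 (lshift n i)).
Local Notation rc x i := (x 0 (rshift n i)).

Definition Qmap (x y : 'rV[R]_(n + n)) : 'rV[R]_(n + n) :=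
  row_mx (\row_i (- (lc x i * Pmul (fun j => rc y j) i)))
         (\row_i (- (rc x i * Pmul (fun j => lc y j) i))).

Lemma lc_Q x y i : lc (Qmap x y) i = - (lc x i * Pmul (fun j => rc y j) i).
Proof. by rewrite row_mxEl mxE. Qed.

Lemma rc_Q x y i : rc (Qmap x y) i = - (rc x i * Pmul (fun j => lc y j) i).
Proof. by rewrite row_mxEr mxE. Qed.

Lemma row_lr_eq (x y : 'rV[R]_(n + n)) :
  (forall i, lc x i = lc y i) -> (forall i, rc x i = rc y i) -> x = y.
Proof.
by move=> hl hr; apply/rowP => i; case: (split_ordP i) => j ->.
Qed.

Lemma PmulD (al : R) y y' i :
  Pmul (fun j => al * y j + y' j) i = al * Pmul y i + Pmul y' i.
Proof.
rewrite /Pmul mulr_sumr -big_split; apply: eq_bigr => j _ /=; ring.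
Qed.

Lemma eq_Pmul y y' : y =1 y' -> Pmul y =1 Pmul y'.
Proof. by move=> h i; apply: eq_bigr => j _; rewrite h. Qed.

Lemma Qmap_bilin : bilinear_map Qmap.
Proof.
split=> al h h' k; apply: row_lr_eq => i; rewrite !(lc_Q, rc_Q, mxE).
- by ring.
- by ring.
- rewrite (_ : Pmul _ i = al * Pmul (fun j => rc h' j) i + Pmul (fun j => rc k j) i).
    by ring.
  by rewrite -PmulD; apply: eq_Pmul => j; rewrite !mxE.
- rewrite (_ : Pmul _ i = al * Pmul (fun j => lc h' j) i + Pmul (fun j => lc k j) i).
    by ring.
  by rewrite -PmulD; apply: eq_Pmul => j; rewrite !mxE.
Qed.

Lemma quadratic_lc x i : lc (quadratic Qmap (const_mx (-1)) x) i
  = lc x i - lc x i * Pmul (fun j => rc x j) i - 1.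
Proof. by rewrite mxE [X in X + _]mxE lc_Q mxE. Qed.

Lemma quadratic_rc x i : rc (quadratic Qmap (const_mx (-1)) x) i
  = rc x i - rc x i * Pmul (fun j => lc x j) i - 1.
Proof. by rewrite mxE [X in X + _]mxE rc_Q mxE. Qed.

Lemma fvec_quadratic : fvec 1 0 omega wt = quadratic Qmap (const_mx (-1)).
Proof.
apply/funext => x; rewrite /fvec.
apply: row_lr_eq => i; rewrite ?quadratic_lc ?quadratic_rc ?row_mxEl ?row_mxEr mxE.
- rewrite mxE (_ : (_ *m _) i 0 = Pmul (fun j => rc x j) i)// mxE.
  by apply: eq_bigr => j _; rewrite Pmx_coef !mxE.
- rewrite mxE (_ : (_ *m _) i 0 = Pmul (fun j => lc x j) i)// mxE.
  by apply: eq_bigr => j _; rewrite Ptmx_coef !mxE.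
Qed.

Definition Lsum (x : 'rV[R]_(n + n)) := \sum_i wt i * lc x i.
Definition Rsum (x : 'rV[R]_(n + n)) := \sum_i wt i * rc x i.

Lemma Lsum_linear (al : R) x y : Lsum (al *: x + y) = al * Lsum x + Lsum y.
Proof.
rewrite /Lsum mulr_sumr -big_split; apply: eq_bigr => i _ /=; rewrite !mxE; ring.
Qed.

Lemma Rsum_linear (al : R) x y : Rsum (al *: x + y) = al * Rsum x + Rsum y.
Proof.
rewrite /Rsum mulr_sumr -big_split; apply: eq_bigr => i _ /=; rewrite !mxE; ring.
Qed.

(* The two halves of the cross terms combine because
   wt_i P_ij + wt_j P_ji = wt_i wt_j / 2. *)
Lemma sum_Q x y : Lsum (Qmap x y) + Rsum (Qmap y x) = - (Lsum x * Rsum y) / 2.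
Proof.
rewrite /Lsum /Rsum.
under eq_bigr do rewrite lc_Q /Pmul mulrN mulrA mulr_sumr.
under [X in _ + X = _]eq_bigr do rewrite rc_Q /Pmul mulrN mulrA mulr_sumr.
rewrite !sumrN [X in _ - X]exchange_big -opprD -big_split /= mulNr; congr (- _).
rewrite mulr_suml mulr_suml; apply: eq_bigr => i _.
rewrite mulr_sumr mulr_suml -big_split; apply: eq_bigr => j _ /=.
have := Pcoef_sym i j; move: (Pcoef i j) (Pcoef j i) => p1 p2 h.
transitivity ((wt i * p1 + wt j * p2) * lc x i * rc y j); first by ring.
by rewrite h; ring.
Qed.

(** The right-hand side is a difference of a product of sums and a product of differences of [Lsum]
    and [Rsum], which is where the forms [a] and [b] come from. *)
Lemma sum_polar x y : Lsum (polar Qmap x y) + Rsum (polar Qmap x y)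
  = - (Lsum x * Rsum y + Lsum y * Rsum x) / 2.
Proof.
have L1 := Lsum_linear 1 (Qmap x y) (Qmap y x).
have R1 := Rsum_linear 1 (Qmap x y) (Qmap y x).
rewrite !scale1r !mul1r in L1 R1; rewrite /polar L1 R1.
by have := sum_Q x y; have := sum_Q y x; lra.
Qed.

Lemma Pmul_eq0 y i : (forall j, 0 <= y j) -> Pmul y i = 0 -> forall j, y j = 0.
Proof.
move=> y0 /eqP; rewrite psumr_eq0; last first.
  by move=> j _; rewrite mulr_ge0 ?(ltW (Pcoef_gt0 _ _)).
move=> /allP h j; have := h j (mem_index_enum j).
by rewrite mulf_eq0 gt_eqF ?Pcoef_gt0//= => /eqP.
Qed.

End Kernel.

(** * The minimal solution and the kernel of its Jacobian *)

Section MinimalSolution.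
Variables (R : realType) (n : nat) (omega wt : 'I_n -> R).
Hypotheses (omega_gt0 : forall i, 0 < omega i) (wt_gt0 : forall i, 0 < wt i).
Hypothesis wt_sum : \sum_i wt i = 1.
Local Notation lc x i := (x 0 (lshift n i)).
Local Notation rc x i := (x 0 (rshift n i)).
Local Notation Q := (Qmap omega wt).
Local Notation f := (quadratic Q (const_mx (-1))).
Local Notation F := (polar Q).
Variable xs : 'rV[R]_(n + n).
Hypothesis xsP : minimal_positive_solution f xs.
Let QP := Qmap_bilin omega wt.

Lemma xs_gt0 i : 0 < xs 0 i.
Proof. by case: xsP => /(_ i); rewrite mxE. Qed.

(** Exchanging the two halves gives another positive solution; minimality then yields both
    inequalities. *)
Lemma xs_sym i : lc xs i = rc xs i.
Proof.
case: xsP => x0 fx hmin.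
pose y := row_mx (\row_i rc xs i) (\row_i lc xs i) : 'rV[R]_(n + n).
have yl j : lc y j = rc xs j by rewrite row_mxEl mxE.
have yr j : rc y j = lc xs j by rewrite row_mxEr mxE.
have y0 : ltv 0 y.
  by move=> j; rewrite mxE; case: (split_ordP j) => k ->;
    rewrite ?yl ?yr xs_gt0.
have fy : f y = 0.
  apply: row_lr_eq => j; rewrite ?quadratic_lc ?quadratic_rc [RHS]mxE ?yl ?yr.
    by rewrite (eq_Pmul _ _ yr); have := quadratic_rc omega wt xs j; rewrite fx mxE => /esym.
  by rewrite (eq_Pmul _ _ yl); have := quadratic_lc omega wt xs j; rewrite fx mxE => /esym.
apply/eqP; rewrite eq_le.
have := hmin _ y0 fy (lshift n i); have := hmin _ y0 fy (rshift n i).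
by rewrite yl yr => -> ->.
Qed.

Let u i := lc xs i.

Lemma Pmul_u i : Pmul omega wt u i = 1 - (u i)^-1.
Proof.
have ui : u i != 0 by rewrite gt_eqF// xs_gt0.
case: xsP => _ fx _; have := quadratic_lc omega wt xs i; rewrite fx mxE.
rewrite -(eq_Pmul omega wt xs_sym) -/(u i) => h.
by apply: (mulfI ui); rewrite mulrBr mulr1 mulfV//; rewrite -/u in h; lra.
Qed.

(** The weighted sum [s] of the equations satisfies [s - s ^+ 2 / 4 - 1 = 0], whose only root is the
    double root 2. *)
Lemma sum_u : \sum_i wt i * u i = 2.
Proof.
case: xsP => _ fx _.
have h : \sum_i wt i * u i - (\sum_i wt i * u i) ^+ 2 / 4 - 1 = 0.
  have hP : \sum_i wt i * (u i * Pmul omega wt u i) = (\sum_i wt i * u i) ^+ 2 / 4.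
    have := sum_Q wt omega_gt0 xs xs.
    rewrite /Lsum /Rsum.
    under eq_bigr do rewrite lc_Q -(eq_Pmul omega wt xs_sym) -/(u _) mulrN.
    under [X in _ + X = _]eq_bigr do rewrite rc_Q -xs_sym -/(u _) mulrN.
    under [X in - (_ * X)]eq_bigr do rewrite -xs_sym.
    by rewrite !sumrN -/u; lra.
  rewrite -hP -[X in _ - X]wt_sum -!sumrB big1// => i _.
  have -> : u i * Pmul omega wt u i = u i - 1.
    by rewrite Pmul_u mulrBr mulr1 mulfV// gt_eqF// xs_gt0.
  ring.
apply/eqP; rewrite -subr_eq0 -sqrf_eq0; apply/eqP; lra.
Qed.

Definition kervec : 'rV[R]_(n + n) :=
  row_mx (\row_i (omega i * u i)) (\row_i (omega i * u i)).

Lemma kervec_l i : lc kervec i = omega i * u i.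
Proof. by rewrite row_mxEl mxE. Qed.
Lemma kervec_r i : rc kervec i = omega i * u i.
Proof. by rewrite row_mxEr mxE. Qed.
Lemma kervec_gt0 i : 0 < kervec 0 i.
Proof.
by case: (split_ordP i) => k ->;
  rewrite ?kervec_l ?kervec_r mulr_gt0 ?xs_gt0.
Qed.

Lemma jac_lc v i : lc (v + F xs v) i =
  lc v i / u i - u i * Pmul omega wt (fun j => rc v j) i.
Proof.
rewrite mxE [X in _ + X]mxE !lc_Q -(eq_Pmul omega wt xs_sym) -/u Pmul_u -/(u i).
by rewrite mulrBr mulr1 addrA addrAC opprB addrCA subrr addr0.
Qed.

Lemma jac_rc v i : rc (v + F xs v) i =
  rc v i / u i - u i * Pmul omega wt (fun j => lc v j) i.
Proof.
rewrite mxE [X in _ + X]mxE !rc_Q -/u Pmul_u -xs_sym -/(u i).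
by rewrite mulrBr mulr1 addrA addrAC opprB addrCA subrr addr0.
Qed.

(** Summing [Pcoef_omega] against [wt]-weighted [u] uses [sum_u] to replace the right-hand side by
    [omega i]; this identity makes [kervec] a kernel vector. *)
Lemma Pmul_omega i : Pmul omega wt (fun j => omega j * u j) i = omega i / u i.
Proof.
have h : omega i * Pmul omega wt u i + Pmul omega wt (fun j => omega j * u j) i = omega i.
  rewrite /Pmul mulr_sumr -big_split /=.
  transitivity (\sum_j omega i * ((wt j * u j) / 2)).
    apply: eq_bigr => j _; have := Pcoef_omega wt omega_gt0 i j.
    move: (Pcoef omega wt i j) => p h.
    transitivity ((omega i * p + p * omega j) * u j); first by ring.
    by rewrite h; ring.
  by rewrite -mulr_sumr -mulr_suml sum_u divff ?mulr1// pnatr_eq0.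
by move: h; rewrite Pmul_u; lra.
Qed.

Lemma kervec_ker : kervec + F xs kervec = 0.
Proof.
apply: row_lr_eq => i; rewrite ?jac_lc ?jac_rc [RHS]mxE ?kervec_l ?kervec_r.
  rewrite (eq_Pmul _ _ kervec_r) Pmul_omega mulrK ?unitfE ?gt_eqF ?xs_gt0//.
  by rewrite mulrC divfK ?subrr// gt_eqF ?xs_gt0.
rewrite (eq_Pmul _ _ kervec_l) Pmul_omega mulrK ?unitfE ?gt_eqF ?xs_gt0//.
by rewrite mulrC divfK ?subrr// gt_eqF ?xs_gt0.
Qed.

(* Perron argument: the blocks of f'(xs) coupling u and v are strictly negative,
   so a single zero coordinate propagates to all the others. *)
Lemma ker_ge0_eq0 v j : v + F xs v = 0 -> (forall i, 0 <= v 0 i) -> v 0 j = 0 -> v = 0.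
Proof.
move=> hv v0 vj.
have u0 i : 0 < u i by exact: xs_gt0.
have hl i : lc v i = u i * (u i * Pmul omega wt (fun j => rc v j) i).
  have := jac_lc v i; rewrite hv mxE => /esym/eqP; rewrite subr_eq0 => /eqP <-.
  by rewrite mulrC divfK// gt_eqF.
have hr i : rc v i = u i * (u i * Pmul omega wt (fun j => lc v j) i).
  have := jac_rc v i; rewrite hv mxE => /esym/eqP; rewrite subr_eq0 => /eqP <-.
  by rewrite mulrC divfK// gt_eqF.
have lr i : lc v i = 0 -> forall k, rc v k = 0.
  move=> /eqP; rewrite hl !mulf_eq0 !(gt_eqF (u0 i)) /= => /eqP h.
  by apply: (Pmul_eq0 omega_gt0 wt_gt0 (i := i)) => // k; exact: v0.
have rl i : rc v i = 0 -> forall k, lc v k = 0.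
  move=> /eqP; rewrite hr !mulf_eq0 !(gt_eqF (u0 i)) /= => /eqP h.
  by apply: (Pmul_eq0 omega_gt0 wt_gt0 (i := i)) => // k; exact: v0.
move: vj; case: (split_ordP j) => k -> hk.
  have r0 := lr _ hk; have l0 := rl _ (r0 k).
  by apply: row_lr_eq => i; rewrite mxE ?r0 ?l0.
have l0 := rl _ hk; have r0 := lr _ (l0 k).
by apply: row_lr_eq => i; rewrite mxE ?r0 ?l0.
Qed.

(** With [c] the largest ratio of coordinates of [v] and [kervec], the kernel vector
    [c *: kervec - v] is nonnegative with a zero coordinate, hence zero. *)
Lemma ker_kervec v : (0 < n)%N -> v + F xs v = 0 -> exists c : R, v = c *: kervec.
Proof.
move=> n0 hv; have i0 : 'I_(n + n) := lshift n (Ordinal n0).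
have [j _ hj] := @arg_maxP _ _ _ i0 xpredT (fun i => v 0 i / kervec 0 i) isT.
exists (v 0 j / kervec 0 j); set c := _ / _.
apply/esym/eqP; rewrite -subr_eq0; apply/eqP.
apply: (@ker_ge0_eq0 _ j).
- rewrite (bilinBr (polar_bilin QP)) (bilinZr (polar_bilin QP)).
  by rewrite addrACA -opprD hv subr0 -scalerDr kervec_ker scaler0.
- move=> i; have -> : (c *: kervec - v) 0 i = c * kervec 0 i - v 0 i by rewrite !mxE.
  by rewrite subr_ge0 -ler_pdivrMr ?kervec_gt0//; exact: hj.
- have -> : (c *: kervec - v) 0 j = c * kervec 0 j - v 0 j by rewrite !mxE.
  by rewrite /c divfK ?subrr// gt_eqF ?kervec_gt0.
Qed.

End MinimalSolution.

(** * Reduction of the theorem to the abstract iteration *)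

Lemma scalar_form (R : realType) (m : nat) (g : 'rV[R]_m -> R) :
  (forall (al : R) x y, g (al *: x + y) = al * g x + g y) ->
  exists a : {scalar 'rV[R]_m}, forall x, a x = g x.
Proof.
move=> gl.
pose gM := GRing.isLinear.Build R 'rV[R]_m R *%R g gl.
pose a : {scalar 'rV[R]_m} := HB.pack g gM.
by exists a.
Qed.

Lemma quadratic_newton_step (R : realType) (m : nat)
    (Q : 'rV[R]_m -> 'rV[R]_m -> 'rV[R]_m) (c0 xs x x' zeta : 'rV[R]_m) :
  bilinear_map Q -> quadratic Q c0 xs = 0 ->
  'J (quadratic Q c0) zeta \in unitmx ->
  x' = x - quadratic Q c0 x *m invmx ('J (quadratic Q c0) zeta) ->
  newton_step ('J (quadratic Q c0) xs) (polar Q) (zeta - xs) (x - xs) (x' - xs).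
Proof.
move=> QP fxs u hx'; rewrite /newton_step (quadratic_jacobian c0 QP xs).
have h : (x' - xs) *m 'J (quadratic Q c0) zeta
    = (x - xs) *m 'J (quadratic Q c0) zeta - quadratic Q c0 x.
  by rewrite hx' addrAC mulmxBl mulmxKV.
have fx : quadratic Q c0 x = (x - xs) + polar Q xs (x - xs) + Q (x - xs) (x - xs).
  by rewrite -{1}(subrK xs x) addrC quadraticD// fxs add0r.
rewrite (quadratic_jacobian c0 QP zeta (x' - xs)) in h.
rewrite (quadratic_jacobian c0 QP zeta (x - xs)) in h.
move: h; rewrite {}fx.
rewrite polar_diag scalerA mulVf ?pnatr_eq0// scale1r.
rewrite (bilinBl (polar_bilin QP)).
rewrite (bilinBl (polar_bilin QP)).
set e' := x' - xs; set e := x - xs.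
move: (polar Q zeta e') (polar Q zeta e) (polar Q xs e) (polar Q xs e') (Q e e).
move=> X1 X2 X3 X4 X5 /rowP h; apply/rowP => i.
have := h i; rewrite !mxE; lra.
Qed.

(* Rescaling f'' makes the initial phi-component equal to 1, whatever its sign. *)
Lemma newton_step_scale (R : realType) (m : nat) (A : 'M[R]_m)
    (F : 'rV[R]_m -> 'rV[R]_m -> 'rV[R]_m) (E : R) (zeta e e' : 'rV[R]_m) :
  bilinear_map F -> E != 0 -> newton_step A F zeta e e' ->
  newton_step A (fun h k => E *: F h k) (E^-1 *: zeta) (E^-1 *: e) (E^-1 *: e').
Proof.
move=> FP E0; rewrite /newton_step => h.
rewrite !(bilinZl FP) !(bilinZr FP) !scalerA -scalemxAl mulfV// mul1r.
by rewrite -scalerDr h scalerBr scalerA [E^-1 * 2^-1]mulrC.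
Qed.

Theorem theorem4p3 (R : realType) (n : nat) (c alpha : R)
    (omega wt : 'I_n -> R)
    (hn : (1 <= n)%N)
    (hc : 0 < c <= 1) (halpha : 0 <= alpha < 1)
    (hgl : gauss_legendre omega wt)
    (f : 'rV[R]_(n + n) -> 'rV[R]_(n + n))
    (hf : f = fvec c alpha omega wt)
    (xs : 'rV[R]_(n + n)) (hxs : minimal_positive_solution f xs)
    (hsing : 'J f xs \notin unitmx) (halpha0 : alpha = 0) (hc1 : c = 1)
    (G PN PR : 'M[R]_(n + n))
    (hproj : kernel_range_projections G ('J f xs) PN PR)
    (nrm : 'rV[R]_(n + n) -> R) (hnrm : is_norm nrm)
    (r0 mu0 nu0 : R) (hr0 : 0 < r0) (hmu0 : 0 < mu0) (hnu0 : 0 < nu0)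
    (hbound : forall x : 'rV[R]_(n + n),
       ltv 0 x -> ltv x xs -> nrm (x - xs) <= r0 ->
       opnorm nrm (invmx ('J f x) *m PN) <= mu0 * (nrm (x - xs))^-1 /\
       opnorm nrm (invmx ('J f x) *m PR) <= nu0)
    (B : R) (hB : B = bilin_opnorm nrm (second_derivative f xs))
    (theta r : R) (htheta0 : 0 < theta)
    (htheta : theta < Num.min (1 / (mu0 * B)) 1)
    (hr : r = Num.min r0 (theta * (1 - mu0 * theta * B)
                          / (2 * nu0 * (1 + theta) * B)))
    (x y z : nat -> 'rV[R]_(n + n))
    (hx0 : Wset nrm PN PR xs r theta (x 0%N))
    (hnewton : two_step_newton f x y z) :
  (forall k, [/\ Wset nrm PN PR xs r theta (x k),
                 Wset nrm PN PR xs r theta (y k)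
               & Wset nrm PN PR xs r theta (z k)]) /\
  (forall k, nrm (xs - x k.+1) <=
     (1 + theta) * (1 + mu0 * theta * B) / (2 * (1 - theta)) * nrm (xs - x k)).
Proof.
have og := gl_gt0 hgl; have wg := gl_wt_gt0 hgl; have ws := gl_wt_sum hgl.
have og1 := gl_lt1 hgl.
rewrite {}hf {}halpha0 {}hc1 (fvec_quadratic wt og) in hxs hsing hproj hbound hB hnewton.
clear hc halpha c alpha.
have QP := Qmap_bilin omega wt.
have FP := polar_bilin QP.
set Q := Qmap omega wt in hxs hsing hproj hbound hB hnewton QP FP.
set c0 := const_mx (-1) in hxs hsing hproj hbound hB hnewton.
have fxs : quadratic Q c0 xs = 0 by case: hxs.
have [A AJ] : exists A, A = 'J (quadratic Q c0) xs by eexists.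
rewrite -AJ in hsing hproj.
have AE v : v *m A = v + polar Q xs v by rewrite AJ (quadratic_jacobian c0 QP).
have {hproj} [_ [_ PNker _] [_ PRran _] PNR] := hproj.
have xs0 i : 0 < xs 0 i := xs_gt0 hxs i.
set phi0 := kervec omega xs.
have phi0_gt0 i : 0 < phi0 0 i := kervec_gt0 og hxs i.
have phi0_n0 : phi0 != 0.
  apply/eqP => h; have := phi0_gt0 (lshift n (Ordinal hn)).
  by rewrite h mxE ltxx.
have nphi0 : 0 < nrm phi0 := nrm_gt0 hnrm phi0_n0.
set phi := (nrm phi0)^-1 *: phi0.
have phi1 : nrm phi = 1.
  by rewrite nrmZ// gtr0_norm ?invr_gt0// mulVf// gt_eqF.
have phi_gt0 i : 0 < phi 0 i by rewrite mxE mulr_gt0 ?invr_gt0.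
have Lphi : Lsum wt phi = Rsum wt phi.
  apply: eq_bigr => i _.
  have -> : phi 0 (lshift n i) = (nrm phi0)^-1 * phi0 0 (lshift n i) by rewrite mxE.
  have -> : phi 0 (rshift n i) = (nrm phi0)^-1 * phi0 0 (rshift n i) by rewrite mxE.
  by rewrite kervec_l kervec_r.
pose sigma := Lsum wt phi + Rsum wt phi.
have sigma_gt0 : 0 < sigma.
  have h : 0 < Lsum wt phi.
    rewrite /Lsum (bigD1 (Ordinal hn))//= ltr_pwDl ?mulr_gt0//.
    by apply: sumr_ge0 => i _; rewrite mulr_ge0 ?ltW.
  by rewrite /sigma -Lphi addr_gt0.
have sigma_n0 : sigma != 0 by rewrite gt_eqF.
have [a aE] : exists a : {scalar 'rV[R]_(n + n)},
    forall v, a v = (Lsum wt v + Rsum wt v) / sigma.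
  by apply: scalar_form => al v w; rewrite Lsum_linear Rsum_linear; ring.
have [b bE] : exists b : {scalar 'rV[R]_(n + n)},
    forall v, b v = (Lsum wt v - Rsum wt v) / sigma.
  by apply: scalar_form => al v w; rewrite Lsum_linear Rsum_linear; ring.
have a_phi : a phi = 1 by rewrite aE divff.
have b_phi : b phi = 0 by rewrite bE Lphi subrr mul0r.
have Lxs : Lsum wt xs = 2 by exact: (sum_u og ws hxs).
have Rxs : Rsum wt xs = 2.
  by rewrite -Lxs; apply: eq_bigr => i _; rewrite (xs_sym hxs).
have a_A v : a (v *m A) = 0.
  rewrite AE linearD !aE -mulrDl sum_polar// Lxs Rxs; apply/eqP.
  by rewrite mulf_eq0; apply/orP; left; apply/eqP; lra.
have phi_A : phi *m A = 0.
  by rewrite -scalemxAl AE (kervec_ker og ws hxs) scaler0.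
have A_ker v : v *m A = 0 -> v = a v *: phi.
  rewrite AE => /(ker_kervec og wg ws hxs hn)[d ->].
  have -> : kervec omega xs = nrm phi0 *: phi by rewrite scalerA mulfV ?gt_eqF// scale1r.
  by rewrite scalerA [a _]linearZ/= a_phi mulr1.
have PRA (v : 'rV[R]_(n + n)) : exists w : 'rV[R]_(n + n), v *m PR = w *m A.
  by apply/submxP; rewrite -PRran submxMl.
(* [a] vanishes on the image of [PR], and [v *m PN] lies in the kernel, so [a] is the coordinate
   along [phi] for this splitting. *)
have PN_E v : v *m PN = a v *: phi.
  have -> : a v = a (v *m PN).
    rewrite -[v in LHS]mulmx1 -PNR mulmxDr linearD.
    by have [w ->] := PRA v; rewrite a_A addr0.
  by apply: A_ker; apply/sub_kermxP; rewrite -PNker submxMl.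
have A_range v : a v = 0 -> exists w, v = w *m A.
  move=> av; have [w hw] := PRA v; exists w.
  by rewrite -hw -[LHS]mulmx1 -PNR mulmxDr PN_E av scale0r add0r.
pose K := - (sigma / 4).
have K_n0 : K != 0 by rewrite oppr_eq0 mulf_neq0// invr_eq0 pnatr_eq0.
have a_F h k : a (polar Q h k) = K * (a h * a k - b h * b k).
  rewrite !aE !bE sum_polar// /K; move: sigma_n0; move: (sigma) => s s0.
  by field.
(* For [t < nrm phi0] the vector [t *: phi] stays below [phi0], which is below [xs] because the
   nodes are less than 1; so [xs - t *: phi] is positive. *)
pose t0 := Num.min (nrm phi0) r0.
have t0_gt0 : 0 < t0 by rewrite lt_min nphi0.
pose J t := 'J (quadratic Q c0) (xs - t *: phi).
have J_E t v : v *m J t = v *m A - t *: polar Q phi v.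
  by rewrite /J (quadratic_jacobian c0 QP) (bilinBl FP) (bilinZl FP) AE addrA.
have J_bound t : 0 < t -> t < t0 ->
    opnorm nrm (invmx (J t) *m PN) <= mu0 * t^-1 /\
    opnorm nrm (invmx (J t) *m PR) <= nu0.
  move=> tgt; rewrite lt_min => /andP[tphi tr0].
  have nt : nrm (xs - t *: phi - xs) = t.
    by rewrite addrAC subrr add0r -scaleNr nrmZ// phi1 mulr1 normrN gtr0_norm.
  rewrite -[t in mu0 * t^-1]nt; apply: hbound.
  - move=> i; have -> : (xs - t *: phi) 0 i = xs 0 i - t * ((nrm phi0)^-1 * phi0 0 i).
      by rewrite !mxE.
    rewrite mxE subr_gt0.
    have phixs : phi0 0 i < xs 0 i.
      case: (split_ordP i) => j ->; rewrite /phi0 ?kervec_l ?kervec_r -?(xs_sym hxs);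
        by rewrite gtr_pMl.
    rewrite (le_lt_trans _ phixs)// mulrA ler_piMl ?(ltW (phi0_gt0 i))//.
    by rewrite ler_pdivrMr// mul1r ltW.
  - move=> i; have -> : (xs - t *: phi) 0 i = xs 0 i - t * phi 0 i by rewrite !mxE.
    by rewrite ltrBlDr ltrDl mulr_gt0.
  - by rewrite nt ltW.
have le_nu0 := range_bound hnrm PN_E PNR phi1 a_phi b_phi a_A A_ker FP K_n0 a_F
  hnu0 t0_gt0 J_E J_bound.
have le_mu0 := form_bound hnrm PN_E PNR phi1 a_phi b_phi a_A phi_A A_ker A_range FP
  K_n0 a_F hmu0 t0_gt0 J_E J_bound.
have {hB} hB : B = bilin_opnorm nrm (polar Q).
  by rewrite hB; congr bilin_opnorm; apply/funext => h; apply/funext => k;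
    exact: quadratic_derive2.
have le_B h k : nrm (polar Q h k) <= B * (nrm h * nrm k).
  by rewrite hB; exact: bilin_opnorm_le.
have le_L h k : `|a h * a k - b h * b k| <= mu0 * B * (nrm h * nrm k).
  have := le_mu0 (polar Q h k); rewrite a_F normrM mulrAC [leRHS]mulrC.
  rewrite ler_pM2l ?normr_gt0// => /le_trans; apply.
  by rewrite -mulrA ler_pM2l.
(* Testing the bound on [phi] itself makes [B] positive and gives [theta <= rho]. *)
have muB : 1 <= mu0 * B.
  by have := le_L phi phi; rewrite a_phi b_phi phi1 mul0r subr0 !mulr1 normr1.
have B_gt0 : 0 < B by rewrite -(pmulr_rgt0 _ hmu0) (lt_le_trans ltr01).
have [theta1 rho1] : theta < 1 /\ mu0 * B * theta < 1.
  move: htheta; rewrite lt_min => /andP[h ->]; split => //.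
  by rewrite mulrC -ltr_pdivlMr// (lt_le_trans ltr01).
pose rho := mu0 * B * theta.
pose N := theta * (1 - rho ^+ 2) / (2 * (1 + theta)).
have theta2 : 0 < 1 + theta by rewrite addr_gt0.
have params : cone_params theta rho N.
  split => //; first by rewrite ler_peMl// ltW.
  rewrite /N; move: (theta) (rho) (lt0r_neq0 theta2) => s1 s2 s3; field.
  exact: s3.
pose E := a (x 0%N - xs).
have step_y k : newton_step A (polar Q) (zprev x z k - xs) (x k - xs) (y k - xs).
  by have [u yE _ _ _] := hnewton k; rewrite AJ; exact: quadratic_newton_step u yE.
have step_x k : newton_step A (polar Q) (z k - xs) (x k - xs) (x k.+1 - xs).
  by have [_ _ _ u xE] := hnewton k; rewrite AJ; exact: quadratic_newton_step u xE.
have [hx0r hx0c] := hx0.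
rewrite PN_E nrmZ// phi1 mulr1 in hx0c.
(* If [E] vanished, the cone condition would force x_0 to equal [xs], where the first Jacobian would
   be singular. *)
have E0 : E != 0.
  apply/eqP => aE0; case/negP: hsing; have [u _ _ _ _] := hnewton 0%N.
  suff xx : x 0%N = xs by rewrite AJ -xx.
  apply/eqP; rewrite -subr_eq0; apply/eqP.
  rewrite -[LHS]mulmx1 -PNR mulmxDr PN_E -/E aE0 scale0r add0r.
  apply: (norm_definite hnrm); apply/eqP; rewrite eq_le (nrm_ge0 hnrm) andbT.
  by rewrite (le_trans hx0c)// -/E aE0 normr0 mulr0.
have nE0 : 0 < `|E| by rewrite normr_gt0.
pose F' h k := E *: polar Q h k.
have F'P : bilinear_map F'.
  by split=> al h h' k; rewrite /F' ?(bilinDl FP) ?(bilinDr FP) ?(bilinZl FP) ?(bilinZr FP);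
    rewrite scalerDr !scalerA [E * al]mulrC.
pose e' k := E^-1 *: (x k - xs).
pose g' k := E^-1 *: (y k - xs).
pose z' k := E^-1 *: (z k - xs).
have F'C h k : F' h k = F' k h by rewrite /F' polarC.
have EK0 : E * K != 0 by rewrite mulf_neq0.
have a_F' h k : a (F' h k) = E * K * (a h * a k - b h * b k).
  by rewrite linearZ/= a_F mulrA.
have B'_gt0 : 0 < `|E| * B by rewrite mulr_gt0.
(* Rescaling multiplies the bound on f'' by [|E|] but leaves [le_L] as it is, since [a] and [b] do
   not change. *)
have le_B' h k : nrm (F' h k) <= `|E| * B * (nrm h * nrm k).
  by rewrite nrmZ// -mulrA ler_pM2l.
have z'E k : z' k = 2^-1 *: (e' k + g' k).
  have [_ _ zE _ _] := hnewton k; rewrite /z' /e' /g' zE.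
  apply/rowP => i; rewrite !mxE; move: (E^-1) => E1; by field.
have gE k : newton_step A F' (zprev e' z' k) (e' k) (g' k).
  have -> : zprev e' z' k = E^-1 *: (zprev x z k - xs) by case: k.
  exact: newton_step_scale.
have eE k : newton_step A F' (z' k) (e' k) (e' k.+1).
  exact: newton_step_scale.
have a_e0 : a (e' 0%N) = 1 by rewrite linearZ/= mulVf.
have nV v : nrm (E^-1 *: v) = `|E|^-1 * nrm v by rewrite nrmZ// normfV.
have p_e0 : relR nrm PR theta (e' 0%N) <= 1.
  rewrite /relR -scalemxAl nV ler_pdivrMr// mul1r ler_pdivrMl// mulrC//.
(* The factors [|E|] cancel; the second entry of the minimum in [r], multiplied by [1 + rho], gives
   [N]. *)
have small : nu0 * (`|E| * B) * nrm (e' 0%N) * (1 + rho) <= N.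
  have -> : nu0 * (`|E| * B) * nrm (e' 0%N) = nu0 * B * nrm (x 0%N - xs).
    rewrite nV; move: (lt0r_neq0 nE0); move: (nrm _) (`|E|) => s1 s2 s20.
    by field.
  have r0' : 0 <= rho by rewrite mulr_ge0 ?ltW// mulr_gt0.
  have h1 : nrm (x 0%N - xs) <=
      theta * (1 - mu0 * theta * B) / (2 * nu0 * (1 + theta) * B).
    by rewrite ltW// (lt_le_trans hx0r)// hr ge_min lexx orbT.
  have D0 : 0 < 2 * nu0 * (1 + theta) * B by rewrite !mulr_gt0.
  rewrite ler_pdivlMr// in h1; rewrite /N ler_pdivlMr ?mulr_gt0//.
  have h2 : 0 <= 1 + rho by rewrite addr_ge0.
  have := ler_wpM2r h2 h1; rewrite /rho; lra.
have cone := newton_cone hnrm PN_E PNR phi1 a_phi b_phi a_A phi_A hnu0 le_nu0 F'P F'C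
  EK0 a_F' le_L B'_gt0 le_B' params (erefl rho) z'E gE eE a_e0 p_e0 small.
have bnd := newton_norm hnrm PN_E PNR phi1 a_phi b_phi a_A phi_A hnu0 le_nu0 F'P F'C
  EK0 a_F' le_L B'_gt0 le_B' params (erefl rho) z'E gE eE a_e0 p_e0 small.
have contr := newton_contraction hnrm PN_E PNR phi1 a_phi b_phi a_A phi_A hnu0 le_nu0 F'P
  F'C EK0 a_F' le_L B'_gt0 le_B' params (erefl rho) z'E gE eE a_e0 p_e0 small.
(* Scaling back by [|E|]: the cone is symmetric in the sign of [a], so the sign of [E] does not
   matter. *)
have inW v : nrm (E^-1 *: (v - xs)) <= nrm (e' 0%N) ->
    0 <= relR nrm PR theta (E^-1 *: (v - xs)) <= a (E^-1 *: (v - xs)) ->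
    Wset nrm PN PR xs r theta v.
  rewrite !nV ler_pM2l ?invr_gt0// => h1 /andP[h2 h3]; split.
    exact: le_lt_trans h1 hx0r.
  rewrite PN_E nrmZ// phi1 mulr1.
  have := le_trans h3 (ler_norm _).
  rewrite /relR -scalemxAl nV linearZ/= normrM normfV -mulrA ler_pM2l ?invr_gt0//.
  by rewrite ler_pdivrMr// mulrC.
split=> k.
  have [c1 c2 c3] := cone k; have [n1 n2 n3] := bnd k.
  by split; apply: inW.
have nS v w : nrm (v - w) = nrm (w - v) by rewrite -(nrmN hnrm) opprB.
rewrite ![nrm (xs - _)]nS; have := contr k; rewrite !nV => h.
have {}h : (1 - theta) * nrm (x k.+1 - xs) <= (1 + theta) / 2 * nrm (x k - xs).
  by rewrite -(ler_pM2l (x := `|E|^-1)) ?invr_gt0// mulrCA (le_trans h)// mulrCA.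
have t1 : 0 < 1 - theta by rewrite subr_gt0.
have h2 : nrm (x k.+1 - xs) <= (1 + theta) / (2 * (1 - theta)) * nrm (x k - xs).
  rewrite -(ler_pM2l t1) (le_trans h)// le_eqVlt; apply/orP; left; apply/eqP.
  by field; rewrite gt_eqF.
rewrite (le_trans h2)// ler_wpM2r ?(nrm_ge0 hnrm)// ler_wpM2r//.
  by rewrite invr_ge0 mulr_ge0 ?ltW.
by rewrite ler_peMr ?(ltW theta2)// lerDl !mulr_ge0// ltW.
Qed.
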